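(* Let $M$ be a spacelike surface in $\mathbb{R}^{3,1}$ with a canonical normal null direction $Z$, where $Z$ is a unit spacelike parallel vector field on $\mathbb{R}^{3,1}$, such that $a=0$ and $\beta=0$. Then the surface $M$ can be parametrized by $$\psi(x,y)=\alpha(y)+x\,Z_0^\top,$$ where $\alpha$ is a curve in $\mathbb{R}^{3,1}$ with $\alpha'(y)$ orthogonal to the constant vector field $Z_0^\top$.
   Context: $\mathbb{R}^{3,1}$ is $\mathbb{R}^4$ with the metric $\langle\cdot,\cdot\rangle=dx_1^2+dx_2^2+dx_3^2-dx_4^2$. A surface $M\subset\mathbb{R}^{3,1}$ is spacelike if the induced metric is Riemannian. For a parallel vector field $Z$ on $\mathbb{R}^{3,1}$ write $Z=Z^\top+Z^\perp$ for its tangent and normal parts along $M$. $M$ has a canonical normal null direction with respect to $Z$ if $Z^\perp$ is a lightlike normal vector field on $M$. Since $Z$ is unit spacelike and $\langle Z^\perp,Z^\perp\rangle=0$, one has $\langle Z^\top,Z^\top\rangle=1$. $B(X,Y)=\overline\nabla_XY-\nabla_XY$ is the second fundamental form, where $\overline\nabla$, $\nabla$ are the Levi-Civita connections of $\mathbb{R}^{3,1}$ and $M$. $W$ is the unit spacelike vector field tangent to $M$ with $\langle Z^\top,W\rangle=0$ and $(Z^\top,W)$ positively oriented. The function $a$ on $M$ is $a=\langle B(W,W),Z^\perp\rangle$. The 1-form $\beta$ on $M$ is defined by $B(X,Z^\top)=\beta(X)Z^\perp$ for all $X\in TM$ (it exists because $\langle B(X,Z^\top),Z^\perp\rangle=0$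 and $Z^\perp$ is lightlike). $Z_0^\top$ denotes the constant value of $Z^\top$. *)

(* Defs.v *)
From mathcomp Require Import all_boot all_order all_algebra.
From mathcomp Require Import all_classical all_reals all_analysis.

Set Implicit Arguments.
Unset Strict Implicit.
Unset Printing Implicit Defensive.

Import Order.TTheory GRing.Theory Num.Theory.
Import numFieldNormedType.Exports.

Local Open Scope classical_set_scope.
Local Open Scope ring_scope.

Section Smooth.
Context {R : realType} {V W : normedModType R}.

(* For finite-dimensional V and open D this is the usual class C^k: f is
   differentiable on D and all its directional derivatives are C^(k-1). *)
Fixpoint Ck_on (k : nat) (D : set V) (f : V -> W) : Prop :=
  match k with
  | 0 => forall x, D x -> {for x, continuous f}
  | k'.+1 => (forall x, D x -> differentiable f x) /\
             (forall v, Ck_on k' D ('D_v f))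
  end.

Definition smooth_on (D : set V) (f : V -> W) : Prop :=
  forall k, Ck_on k D f.

End Smooth.

Section Minkowski.
Context {R : realType}.

Definition mink (u v : 'rV[R]_4) : R :=
  (\sum_(i < 4 | i != ord_max) u 0 i * v 0 i) - u 0 ord_max * v 0 ord_max.

Definition lightlike (v : 'rV[R]_4) : Prop := v != 0 /\ mink v v = 0.

(* The Levi-Civita connection of the flat metric [mink] is the ordinary
   derivative of vector-valued functions. *)
Definition parallel (Z : 'rV[R]_4 -> 'rV[R]_4) : Prop :=
  forall x, differentiable Z x /\ forall v, 'D_v Z x = 0.

End Minkowski.

(* [par] is a local parametrization with parameter domain [dom], and [coord] is
   its inverse.  Outside [dom], respectively [par @` dom], values are junk. *)
Record chart (R : realType) (M : Type) := Chart {
  dom : set (R * R);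
  par : R * R -> M;
  coord : M -> R * R }.

Section Surface.
Context {R : realType} {M : topologicalType}.
Implicit Types (c : chart R M) (A : set (chart R M)).

Definition chart_patch c : set M := par c @` dom c.

Definition is_chart c : Prop :=
  [/\ open (dom c), open (chart_patch c),
      forall u, dom c u -> coord c (par c u) = u,
      forall u, dom c u -> {for u, continuous (par c)} &
      forall p, chart_patch c p -> {for p, continuous (coord c)}].

Definition overlap c1 c2 : set (R * R) :=
  dom c1 `&` (par c1 @^-1` chart_patch c2).

Definition transition c1 c2 : R * R -> R * R := coord c2 \o par c1.

Definition compatible c1 c2 : Prop :=
  smooth_on (overlap c1 c2) (transition c1 c2) /\
  smooth_on (overlap c2 c1) (transition c2 c1).

Definition jacobian (f : R * R -> R * R) (u : R * R) : R :=
  let d1 := 'D_((1, 0) : R * R) f u in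
  let d2 := 'D_((0, 1) : R * R) f u in
  d1.1 * d2.2 - d1.2 * d2.1.

Definition oriented_atlas A : Prop :=
  [/\ forall c, A c -> is_chart c,
      forall p, exists2 c, A c & chart_patch c p,
      forall c1 c2, A c1 -> A c2 -> compatible c1 c2 &
      forall c1 c2 u, A c1 -> A c2 -> overlap c1 c2 u ->
        0 < jacobian (transition c1 c2) u].

Definition oriented_surface A : Prop :=
  [/\ hausdorff_space M, @second_countable M & oriented_atlas A].

(* Local parametrizations of M, of either orientation. *)
Definition parametrization A c : Prop :=
  is_chart c /\ forall c', A c' -> compatible c c'.

Definition smooth_map {V : normedModType R} A (g : M -> V) : Prop :=
  forall c, A c -> smooth_on (dom c) (g \o par c).

Definition immersion A (phi : M -> 'rV[R]_4) : Prop :=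
  smooth_map A phi /\
  forall c u (xi : R * R), A c -> dom c u ->
    'D_xi (phi \o par c) u = 0 -> xi = 0.

End Surface.

(* Tangent vectors of M at p are represented by their images under the
   differential of the immersion phi, hence as vectors of R^4; a vector field
   tangent to M is accordingly a map M -> R^4. *)
Section ImmersedSurface.
Context {R : realType} {M : topologicalType}.
Variables (A : set (chart R M)) (phi : M -> 'rV[R]_4).

(* In the chart c at u, the coordinate vector xi represents v at p. *)
Definition represents (c : chart R M) (u xi : R * R) (p : M) (v : 'rV[R]_4) :=
  [/\ A c, dom c u, par c u = p & 'D_xi (phi \o par c) u = v].

Definition tangent (p : M) (v : 'rV[R]_4) : Prop :=
  exists c u xi, represents c u xi p v.

Definition normal (p : M) (n : 'rV[R]_4) : Prop :=
  forall v, tangent p v -> mink n v = 0.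

Definition spacelike_surface : Prop :=
  forall p v, tangent p v -> v != 0 -> 0 < mink v v.

Definition positively_oriented (p : M) (v w : 'rV[R]_4) : Prop :=
  exists c u (xi eta : R * R),
    [/\ represents c u xi p v, represents c u eta p w &
        0 < xi.1 * eta.2 - xi.2 * eta.1].

Definition tangent_field (X : M -> 'rV[R]_4) : Prop :=
  smooth_map A X /\ forall p, tangent p (X p).

Definition normal_field (N : M -> 'rV[R]_4) : Prop :=
  smooth_map A N /\ forall p, normal p (N p).

(* The derivative dg_p(v) of g : M -> V along v tangent to M at p, computed in
   a chart; for smooth g it does not depend on the chart, so that the set below
   is a singleton. *)
Definition dmap {V : normedModType R} (g : M -> V) (p : M) (v : 'rV[R]_4) : V :=
  xget 0 [set w | exists c u xi,
    represents c u xi p v /\ w = 'D_xi (g \o par c) u].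

(* Levi-Civita connection of the metric induced on M by [mink]: torsion is
   expressed through the action of vector fields on functions,
   [X, Y] f = X (Y f) - Y (X f). *)
Definition levi_civita
    (nabla : (M -> 'rV[R]_4) -> (M -> 'rV[R]_4) -> (M -> 'rV[R]_4)) : Prop :=
  (forall X Y, tangent_field X -> tangent_field Y ->
    tangent_field (nabla X Y)) /\
  (forall X1 X2 Y, tangent_field X1 -> tangent_field X2 -> tangent_field Y ->
    forall p, nabla (fun q => X1 q + X2 q) Y p = nabla X1 Y p + nabla X2 Y p) /\
  (forall (f : M -> R) X Y, smooth_map A f ->
    tangent_field X -> tangent_field Y ->
    forall p, nabla (fun q => f q *: X q) Y p = f p *: nabla X Y p) /\
  (forall X Y1 Y2, tangent_field X -> tangent_field Y1 -> tangent_field Y2 ->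
    forall p, nabla X (fun q => Y1 q + Y2 q) p = nabla X Y1 p + nabla X Y2 p) /\
  (forall (f : M -> R) X Y, smooth_map A f ->
    tangent_field X -> tangent_field Y ->
    forall p, nabla X (fun q => f q *: Y q) p =
              dmap f p (X p) *: Y p + f p *: nabla X Y p) /\
  (forall X Y (f : M -> R), tangent_field X -> tangent_field Y ->
    smooth_map A f ->
    forall p, dmap f p (nabla X Y p - nabla Y X p) =
              dmap (fun q => dmap f q (Y q)) p (X p) -
              dmap (fun q => dmap f q (X q)) p (Y p)) /\
  (forall X Y V, tangent_field X -> tangent_field Y -> tangent_field V ->
    forall p, dmap (fun q => mink (Y q) (V q)) p (X p) =
              mink (nabla X Y p) (V p) + mink (Y p) (nabla X V p)).

(* B(X, Y); the Levi-Civita connection of the ambient space along M is the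
   derivative [dmap] of R^4-valued maps. *)
Definition second_ff
    (nabla : (M -> 'rV[R]_4) -> (M -> 'rV[R]_4) -> (M -> 'rV[R]_4))
    (X Y : M -> 'rV[R]_4) (p : M) : 'rV[R]_4 :=
  dmap Y p (X p) - nabla X Y p.

Definition tangent_normal_parts
    (Z : 'rV[R]_4 -> 'rV[R]_4) (ZT ZN : M -> 'rV[R]_4) : Prop :=
  [/\ tangent_field ZT, normal_field ZN & forall p, Z (phi p) = ZT p + ZN p].

Definition oriented_unit_normal_to (ZT W : M -> 'rV[R]_4) : Prop :=
  tangent_field W /\
  forall p, [/\ mink (W p) (W p) = 1, mink (ZT p) (W p) = 0 &
                positively_oriented p (ZT p) (W p)].

Definition one_form (beta : M -> 'rV[R]_4 -> R) : Prop :=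
  (forall p v w (t : R), tangent p v -> tangent p w ->
    beta p (t *: v + w) = t * beta p v + beta p w) /\
  (forall X, tangent_field X -> smooth_map A (fun p => beta p (X p) : R)).

End ImmersedSurface.

(* Main.v *)
Require Import Defs.
From HB Require Import structures.
From mathcomp Require Import all_boot all_order all_algebra.
From mathcomp Require Import all_classical all_reals all_analysis.
From mathcomp Require Import ring lra.

Set Implicit Arguments.
Unset Strict Implicit.
Unset Printing Implicit Defensive.

Import Order.TTheory GRing.Theory Num.Theory.
Import numFieldNormedType.Exports.

Local Open Scope classical_set_scope.
Local Open Scope ring_scope.

(** A parallel field on the ambient space is a constant vector [z0], so along
    the surface [z0 = ZT + ZN] and [dZN = - dZT].  The first half shows [dZT = 0]
    by computing it in the orthonormal frame [(ZT, W)] of the tangent planes.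
    Since [beta = 0], the vector [dZT(X) = B(X, ZT) + nabla_X ZT] is tangent, so
    only its two frame components matter.  The [ZT]-component vanishes because
    [<ZT, ZT> = <z0, z0> = 1] is constant ([dZT_orthogonal_ZT]).  Differentiating
    [<ZN, W> = 0] turns the [W]-component into [<ZN, dW(X)>] ([mink_dZT_W]).  For
    [X = W] this is [a = 0], up to the tangent vector [nabla_W W].  For [X = ZT]
    the difference [dW(ZT) - dZT(W)] is the Lie bracket [[ZT, W]], which is
    tangent ([mink_ZN_bracket]), so the component equals [<ZN, dZT(W)> = 0].
    Connectedness of the surface then makes [ZT] a constant vector [Z0].

    For the parametrization near a point [p], no flow of [ZT] is integrated.
    Take instead the map [F = (<Z0, phi>, <W p, phi>)] to the plane.  At [p] its
    differential sends the orthonormal tangent basis [(Z0, W p)] to the standard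
    basis, so by the inverse function theorem [F] is the coordinate map of a
    chart [c] over a square ([chart_of_coordinates]).  At every point [Z0] is
    tangent and [dF(Z0) = (<Z0, Z0>, <W p, Z0>) = (1, 0)]; hence [Z0] is the
    first coordinate vector of [c] everywhere ([derive_par_coordinates]).
    Therefore [phi (par c (x, y)) - x Z0] depends on [y] only: it is [alpha y].
    Finally [<Z0, alpha y> = 0], as the first coordinate of [par c (x, y)] is
    [<Z0, phi (par c (x, y))> = x]; differentiating gives orthogonality.

    The calculus used is developed for maps between normed modules (directional
    derivatives, maps of class C^k) and for the plane (inverse function theorem,
    by a contraction estimate and a minimum on a compact square). *)

(** * Directional derivatives *)

Section DirectionalDerivatives.
Context {R : realType}.
Implicit Types U V W : normedModType R.

Lemma is_diff_scale V W (k dk : V -> R) (g dg : V -> W) (x : V) :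
  is_diff x k dk -> is_diff x g dg ->
  is_diff x (fun y => k y *: g y) (fun v => k x *: dg v + dk v *: g x).
Proof.
move=> kx gx.
have scbil : bilinear_for (GRing.Scale.Law.clone _ _ *:%R _)
    (GRing.Scale.Law.clone _ _ *:%R _) (@GRing.scale R W).
  split=> [u' | u] a y z /=; first by rewrite scalerDl scalerA.
  by rewrite scalerDr !scalerA mulrC.
pose scM := bilinear_isBilinear.Build R R W W _ _ _ scbil.
pose sc : {bilinear R -> W -> W} := HB.pack (@GRing.scale R W) scM.
have sccont : continuous (fun p : R * W => sc p.1 p.2).
  by move=> p; exact: scale_continuous.
have scdiff : is_diff (k x, g x) (fun p : R * W => p.1 *: p.2)
    (fun q => k x *: q.2 + q.1 *: g x).
  apply: DiffDef; first exact: (differentiable_bilin (k x, g x) sccont).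
  exact: (diff_bilin (k x, g x) sccont).
exact: (@is_diff_comp _ _ _ _ (fun y => (k y, g y)) (fun v => (dk v, dg v))
  (fun p : R * W => p.1 *: p.2)).
Qed.

Lemma diff_derive V W (f : V -> W) (x : V) :
  differentiable f x -> 'd f x = (fun v => 'D_v f x) :> (V -> W).
Proof. by move=> df; apply/funext => v; rewrite deriveE. Qed.

Lemma is_diff_derive V W (f df : V -> W) (x v : V) :
  is_diff x f df -> 'D_v f x = df v.
Proof. by move=> fx; rewrite deriveE ?diff_val //; apply: ex_diff. Qed.

Lemma differentiable_derive V W (f : V -> W) (x : V) :
  differentiable f x -> is_diff x f (fun v => 'D_v f x).
Proof. by move=> df; apply: DiffDef => //; exact: diff_derive. Qed.

Lemma differentiable_scale V W (k : V -> R) (g : V -> W) (x : V) :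
  differentiable k x -> differentiable g x ->
  differentiable (fun y => k y *: g y) x.
Proof.
move=> /differentiable_derive dk /differentiable_derive dg.
by have := is_diff_scale dk dg => -[].
Qed.

Lemma derive_scale V W (k : V -> R) (g : V -> W) (x v : V) :
  differentiable k x -> differentiable g x ->
  'D_v (fun y => k y *: g y) x = k x *: 'D_v g x + 'D_v k x *: g x.
Proof.
move=> /differentiable_derive dk /differentiable_derive dg.
exact: (is_diff_derive v (is_diff_scale dk dg)).
Qed.

Lemma derive_linear V W (f : V -> W) (x u v : V) (t : R) :
  differentiable f x -> 'D_(t *: u + v) f x = t *: 'D_u f x + 'D_v f x.
Proof. by move=> df; rewrite !deriveE // linearP. Qed.

Lemma derive_comp U V W (f : U -> V) (g : V -> W) (x v : U) :
  differentiable f x -> differentiable g (f x) ->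
  'D_v (g \o f) x = 'D_('D_v f x) g (f x).
Proof.
move=> df dg; rewrite deriveE; last exact: differentiable_comp.
by rewrite diff_comp // !deriveE.
Qed.

Lemma derive_pair U V W (f : U -> V) (g : U -> W) (x v : U) :
  differentiable f x -> differentiable g x ->
  'D_v (fun y => (f y, g y)) x = ('D_v f x, 'D_v g x).
Proof.
move=> /differentiable_derive df /differentiable_derive dg.
exact: (is_diff_derive v (is_diff_pair df dg)).
Qed.

Lemma derive_lincomp U V W (f : U -> V) (L : {linear V -> W}) (x v : U) :
  continuous L -> differentiable f x -> 'D_v (L \o f) x = L ('D_v f x).
Proof.
move=> cL df; rewrite derive_comp //; last exact: linear_differentiable.
by rewrite deriveE ?diff_lin //; exact: linear_differentiable.
Qed.

Lemma derive_inv V (f : V -> R) (x v : V) :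
  differentiable f x -> f x != 0 ->
  'D_v (fun y => (f y)^-1) x = - ((f x)^-1 * (f x)^-1) * 'D_v f x.
Proof.
move=> df f0; rewrite deriveE; last exact: differentiableV.
by rewrite diffV //= deriveE // -expr2 exprVn.
Qed.

Lemma derive_basis W (f : R * R -> W) (u v : R * R) :
  differentiable f u ->
  'D_v f u = v.1 *: 'D_((1, 0) : R * R) f u + v.2 *: 'D_((0, 1) : R * R) f u.
Proof.
case: v => a b df /=.
have -> : (a, b) = a *: ((1, 0) : R * R) + (b *: ((0, 1) : R * R) + 0).
  by rewrite addr0; congr pair; rewrite /= /GRing.scale /= ?mulr1 ?mulr0 ?addr0 ?add0r.
by rewrite !derive_linear // derive0 addr0.
Qed.

Lemma differentiable_approx V W (f : V -> W) (x : V) :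
  differentiable f x -> forall e : R, 0 < e ->
  \forall y \near x, `|f y - f x - 'd f x (y - x)| <= e * `|y - x|.
Proof.
move=> /diff_locally/eqaddoP df e e0.
have := df e e0; rewrite -{1}(subrr x) => dfe.
have sub : (fun y : V => y - x) @ x --> x - x.
  by apply: cvgB; [exact: cvg_id | exact: cvg_cst].
apply: filterS (sub _ dfe : nbhs x _) => y /=.
by rewrite !fctE /= subrK opprD addrA.
Qed.

(** Differentiability in epsilon form, free of Landau notation: this is how
    the local inverse of a map and a locally equal map are differentiated. *)
Lemma is_diffI_approx V W (f : V -> W) (L : {linear V -> W}) (x : V) :
  continuous L -> (forall e : R, 0 < e ->
    \forall y \near x, `|f y - f x - L (y - x)| <= e * `|y - x|) ->
  is_diff x f L.
Proof.
move=> cL approx.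
have fL : f \o shift x = cst (f x) + L +o_ 0 id.
  apply/eqaddoP => e e0.
  have shft : (fun h : V => h + x) @ (0 : V) --> x.
    by rewrite -[X in _ --> X](add0r x); apply: cvgD; [exact: cvg_id|exact: cvg_cst].
  apply: filterS (shft _ (approx e e0) : nbhs (0 : V) _) => h /=.
  by rewrite !fctE /= addrK opprD addrA.
by apply: DiffDef; [apply/diff_locallyP|]; rewrite (diff_unique cL fL).
Qed.

Lemma near_eq_differentiable V W (f g : V -> W) (x : V) :
  (\forall y \near x, f y = g y) -> differentiable f x -> differentiable g x.
Proof.
move=> fg df; suff : is_diff x g ('d f x) by move=> dg; exact: ex_diff.
apply: is_diffI_approx; first exact: diff_continuous.
have fgx := nbhs_singleton fg => e e0.
by apply: filterS2 fg (differentiable_approx df e0) => y <-; rewrite -fgx.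
Qed.

End DirectionalDerivatives.

(** * Maps of class C^k *)

Section SmoothMaps.
Context {R : realType}.
Implicit Types (U V W : normedModType R) (k : nat).

Lemma Ck_on_sub V W k (D D' : set V) (f : V -> W) :
  D' `<=` D -> Ck_on k D f -> Ck_on k D' f.
Proof.
move=> sub; elim: k f => [|k IH] f /=; first by move=> fD x /sub/fD.
by move=> [df Df]; split=> [x /sub/df | v]; [|exact/IH/Df].
Qed.

(** Openness of the set matters: derivatives at a point of [D] see a
    neighbourhood of it. *)
Lemma Ck_on_ext V W k (D : set V) (f g : V -> W) :
  open D -> (forall x, D x -> f x = g x) -> Ck_on k D f -> Ck_on k D g.
Proof.
move=> oD; elim: k f g => [|k IH] f g fg.
  move=> /= fD x Dx; have nfg : \forall y \near x, f y = g y.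
    by apply: filterS (open_nbhs_nbhs (conj oD Dx)) => y /fg.
  rewrite /prop_for /continuous_at -(fg x Dx).
  apply: cvg_trans (fD x Dx); exact: near_eq_cvg.
move=> [df Df]; split=> [x Dx | v].
  have nfg : \forall y \near x, f y = g y.
    by apply: filterS (open_nbhs_nbhs (conj oD Dx)) => y /fg.
  exact: near_eq_differentiable nfg (df x Dx).
apply: IH (Df v) => x Dx; apply: near_eq_derive.
by apply: filterS (open_nbhs_nbhs (conj oD Dx)) => y /fg.
Qed.

Lemma Ck_onW V W k (D : set V) (f : V -> W) : Ck_on k.+1 D f -> Ck_on k D f.
Proof.
elim: k f => [|k IH] f [df Df].
  by move=> x Dx; exact/differentiable_continuous/df.
by split=> // v; exact/IH/Df.
Qed.

Lemma Ck_on_cst V W k (D : set V) (a : W) : Ck_on k D (cst a : V -> W).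
Proof.
elim: k a => [|k IH] a /=; first by move=> x _; exact: cst_continuous.
split=> [x _|v]; first exact: differentiable_cst.
by rewrite (_ : 'D_v _ = cst 0) //; apply/funext => x; rewrite derive_cst.
Qed.

Lemma Ck_on_lincomp U V W k (D : set U) (L : {linear V -> W}) (f : U -> V) :
  open D -> continuous L -> Ck_on k D f -> Ck_on k D (L \o f).
Proof.
move=> oD cL; elim: k f => [|k IH] f.
  by move=> fD x Dx; apply: continuous_comp; [exact: fD | exact: cL].
move=> [df Df]; split=> [x Dx|v].
  by apply: differentiable_comp; [exact: df | exact: linear_differentiable].
apply: Ck_on_ext oD _ (IH _ (Df v)) => x Dx /=.
by rewrite -derive_lincomp //; exact: df.
Qed.

Lemma Ck_onD V W k (D : set V) (f g : V -> W) :
  open D -> Ck_on k D f -> Ck_on k D g -> Ck_on k D (fun x => f x + g x).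
Proof.
move=> oD; elim: k f g => [|k IH] f g.
  by move=> fD gD x Dx; apply: continuousD; [exact: fD | exact: gD].
move=> [df Df] [dg Dg]; split=> [x Dx|v].
  by apply: differentiableD; [exact: df | exact: dg].
apply: Ck_on_ext oD _ (IH _ _ (Df v) (Dg v)) => x Dx /=.
by rewrite deriveD //; apply: diff_derivable; [exact: df | exact: dg].
Qed.

Lemma Ck_onB V W k (D : set V) (f g : V -> W) :
  open D -> Ck_on k D f -> Ck_on k D g -> Ck_on k D (fun x => f x - g x).
Proof.
move=> oD; elim: k f g => [|k IH] f g.
  by move=> fD gD x Dx; apply: continuousB; [exact: fD | exact: gD].
move=> [df Df] [dg Dg]; split=> [x Dx|v].
  by apply: differentiableB; [exact: df | exact: dg].
apply: Ck_on_ext oD _ (IH _ _ (Df v) (Dg v)) => x Dx /=.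
by rewrite deriveB //; apply: diff_derivable; [exact: df | exact: dg].
Qed.

Lemma Ck_on_id V k (D : set V) : Ck_on k D (id : V -> V).
Proof.
case: k => [|k]; first by move=> x _; exact: cvg_id.
split=> [x _|v]; first exact: ex_diff.
rewrite (_ : 'D_v _ = cst v); first exact: Ck_on_cst.
by apply/funext => x; rewrite derive_id.
Qed.

Lemma Ck_on_scale V W k (D : set V) (f : V -> R) (g : V -> W) :
  open D -> Ck_on k D f -> Ck_on k D g -> Ck_on k D (fun x => f x *: g x).
Proof.
move=> oD; elim: k f g => [|k IH] f g.
  by move=> fD gD x Dx; apply: continuousZ; [exact: fD | exact: gD].
move=> fk gk; have [[df Df] [dg Dg]] := (fk, gk); split=> [x Dx|v].
  by apply: differentiable_scale; [exact: df | exact: dg].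
apply: Ck_on_ext oD _ (Ck_onD oD (IH _ _ (Ck_onW fk) (Dg v))
  (IH _ _ (Df v) (Ck_onW gk))) => x Dx /=.
by rewrite derive_scale //; [exact: df | exact: dg].
Qed.

Lemma Ck_onM V k (D : set V) (f g : V -> R) :
  open D -> Ck_on k D f -> Ck_on k D g -> Ck_on k D (fun x => f x * g x).
Proof. exact: (@Ck_on_scale V R k). Qed.

Lemma Ck_on_pair U V W k (D : set U) (f : U -> V) (g : U -> W) :
  open D -> Ck_on k D f -> Ck_on k D g -> Ck_on k D (fun x => (f x, g x)).
Proof.
move=> oD; elim: k f g => [|k IH] f g.
  by move=> fD gD x Dx; apply: cvg_pair; [exact: fD | exact: gD].
move=> [df Df] [dg Dg]; split=> [x Dx|v].
  by apply: differentiable_pair; [exact: df | exact: dg].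
apply: Ck_on_ext oD _ (IH _ _ (Df v) (Dg v)) => x Dx /=.
by rewrite derive_pair //; [exact: df | exact: dg].
Qed.

Lemma Ck_on_inv V k (D : set V) (f : V -> R) :
  open D -> (forall x, D x -> f x != 0) -> Ck_on k D f ->
  Ck_on k D (fun x => (f x)^-1).
Proof.
move=> oD f0; elim: k => [|k IH].
  by move=> fD x Dx; apply: continuousV; [exact: f0 | exact: fD].
move=> fk; have [df Df] := fk; split=> [x Dx|v].
  by apply: differentiableV; [exact: df | exact: f0].
have fVk := IH (Ck_onW fk).
have m1k := @Ck_on_cst V R k D (-1).
apply: Ck_on_ext oD _ (Ck_on_scale oD (Ck_on_scale oD m1k
  (Ck_on_scale oD fVk fVk)) (Df v)) => x Dx.
rewrite derive_inv ?f0 //; last exact: df.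
by rewrite /GRing.scale /= mulN1r.
Qed.

(** By the chain rule, [D_v (g o f)] is a combination of the partial
    derivatives of [g] composed with [f]; those are one order less regular, so
    the induction on the order closes.  The intermediate space is the plane, where
    a differential is given by two partial derivatives. *)
Lemma Ck_on_comp V W k (D : set V) (E : set (R * R))
    (f : V -> R * R) (g : R * R -> W) :
  open D -> (forall x, D x -> E (f x)) ->
  Ck_on k D f -> Ck_on k E g -> Ck_on k D (g \o f).
Proof.
move=> oD fDE; elim: k g => [|k IH] g.
  move=> fD gE x Dx; apply: continuous_comp; first exact: fD.
  exact/gE/fDE.
move=> fk [dg Dg]; have [df Df] := fk.
split=> [x Dx|v].
  by apply: differentiable_comp; [exact: df | exact/dg/fDE].
have part w : Ck_on k D ('D_w g \o f) := IH _ (Ck_onW fk) (Dg w).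
have cfst : continuous (fst : R * R -> R) by move=> p; exact: cvg_fst.
have csnd : continuous (snd : R * R -> R) by move=> p; exact: cvg_snd.
apply: Ck_on_ext oD _ (Ck_onD oD
  (Ck_on_scale oD (Ck_on_lincomp oD cfst (Df v)) (part (1, 0)))
  (Ck_on_scale oD (Ck_on_lincomp oD csnd (Df v)) (part (0, 1)))) => x Dx /=.
rewrite [RHS]derive_comp; [|exact: df|exact/dg/fDE].
by rewrite [RHS]derive_basis //; exact/dg/fDE.
Qed.

End SmoothMaps.

(** * The mean value theorem along segments *)

Section MeanValue.
Context {R : realType}.
Implicit Types (V W : normedModType R).

Lemma segment_MVT V (f : V -> R) (x v : V) :
  (forall t : R, 0 <= t <= 1 -> differentiable f (x + t *: v)) ->
  exists2 t : R, 0 <= t <= 1 & f (x + v) - f x = 'D_v f (x + t *: v).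
Proof.
move=> df; pose line (t : R) := x + t *: v.
have dline (t : R) : is_diff t line (fun s => s *: v).
  have := is_diffD (is_diff_cst x t) (is_diff_scalel t v).
  by rewrite add0r.
have dfl (t : R) : 0 <= t <= 1 -> is_derive t 1 (f \o line) ('D_v f (line t)).
  move=> t01; have dl : differentiable line t by exact: ex_diff.
  apply: DeriveDef.
    by apply: diff_derivable; apply: differentiable_comp => //; exact: df.
  by rewrite derive_comp //; [rewrite (is_diff_derive (1 : R) (dline t)) scale1r | exact: df].
have [|||t t01] := @MVT_segment R (f \o line) (fun t => 'D_v f (line t)) 0 1.
- exact: ler01.
- by move=> t /[!in_itv]/= /andP[t0 t1]; apply: dfl; rewrite !ltW.
- apply: derivable_within_continuous => t /[!in_itv]/= t01.
  by have := dfl t t01 => -[].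
rewrite /line /= scale1r scale0r addr0 subr0 mulr1 => ft.
by exists t.
Qed.

(** There is no mean value equality for vector-valued maps, so the scalar one
    is applied to each matrix entry. *)
Lemma segment_derive_eq0_const V m n (f : V -> 'M[R]_(m, n)) (x v : V) :
  (forall t : R, 0 <= t <= 1 ->
     differentiable f (x + t *: v) /\ 'D_v f (x + t *: v) = 0) ->
  f (x + v) = f x.
Proof.
move=> f0; apply/matrixP => i j; apply/eqP; rewrite -subr_eq0.
have dfij (t : R) : 0 <= t <= 1 ->
    differentiable (fun y => f y i j) (x + t *: v).
  move=> /f0[df _]; exact: (differentiable_comp df (differentiable_coord _ i j)).
have [t t01 ->] := segment_MVT dfij.
have [df D0] := f0 t t01.
have dv : derivable f (x + t *: v) v by exact: diff_derivable.
have := derive_mx dv; rewrite D0 => /matrixP/(_ i j).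
by rewrite !mxE => <-.
Qed.

End MeanValue.

(** * The inverse function theorem in the plane *)

Section Plane.
Context {R : realType}.
Implicit Types (u v : R * R).

Lemma linear_plane_continuous (W : normedModType R) (L : {linear (R * R)%type -> W}) :
  continuous L.
Proof.
have -> : (L : R * R -> W) =
    fun z => z.1 *: L ((1, 0) : R * R) + z.2 *: L ((0, 1) : R * R).
  apply/funext => -[a b] /=; rewrite -!linearZ -linearD; congr (L _).
  by congr pair; rewrite /= /GRing.scale /= ?mulr1 ?mulr0 ?addr0 ?add0r.
move=> z; apply: cvgD; (apply: cvgZ; last exact: cvg_cst).
- exact: cvg_fst.
- exact: cvg_snd.
Qed.

(** Cramer's rule: the inverse of the linear map sending the standard basis to
    [(d1, d2)]. *)
Definition inv2 (d1 d2 z : R * R) : R * R :=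
  ((d1.1 * d2.2 - d1.2 * d2.1)^-1 * (d2.2 * z.1 - d2.1 * z.2),
   (d1.1 * d2.2 - d1.2 * d2.1)^-1 * (d1.1 * z.2 - d1.2 * z.1)).

Lemma inv2_linear d1 d2 : linear (inv2 d1 d2).
Proof.
move=> t [a b] [c d]; rewrite /inv2 /=; congr pair; rewrite /= /GRing.scale /=; ring.
Qed.

HB.instance Definition _ d1 d2 :=
  GRing.isLinear.Build R (R * R)%type (R * R)%type _ (inv2 d1 d2) (inv2_linear d1 d2).

Lemma inv2K d1 d2 : d1.1 * d2.2 - d1.2 * d2.1 != 0 ->
  cancel (fun v => v.1 *: d1 + v.2 *: d2) (inv2 d1 d2).
Proof.
move: d1 d2 => [a b] [c d] /= J0 [x y]; rewrite /inv2 /=.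
by congr pair; rewrite /= /GRing.scale /=; field.
Qed.

Lemma inv2_inj d1 d2 : d1.1 * d2.2 - d1.2 * d2.1 != 0 ->
  injective (inv2 d1 d2).
Proof.
move: d1 d2 => [a b] [c d] /= J0.
apply: (@can_inj _ _ _ (fun v => v.1 *: ((a, b) : R * R) + v.2 *: ((c, d) : R * R))).
move=> [x y]; rewrite /inv2 /=.
by congr pair; rewrite /= /GRing.scale /=; field.
Qed.

Lemma closed_square_compact (u0 : R * R) (r : R) :
  compact [set u : R * R | `|u - u0| <= r].
Proof.
rewrite (_ : [set _ | _] =
  `[u0.1 - r, u0.1 + r]%classic `*` `[u0.2 - r, u0.2 + r]%classic).
  by apply: compact_setX; exact: segment_compact.
apply/seteqP; split=> -[a b] /=; rewrite prod_normE /= ge_max !ler_distl !in_itv /=.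
  by move=> /andP[].
by move=> [-> ->].
Qed.

Lemma norm_fst_le u : `|u.1| <= `|u|.
Proof. by rewrite prod_normE /= le_max lexx. Qed.

Lemma norm_snd_le u : `|u.2| <= `|u|.
Proof. by rewrite prod_normE /= le_max lexx orbT. Qed.

Lemma derive_plane_le (W : normedModType R) (f : R * R -> W) u v (e : R) :
  differentiable f u -> `|'D_((1, 0) : R * R) f u| <= e ->
  `|'D_((0, 1) : R * R) f u| <= e -> `|'D_v f u| <= `|v| * e + `|v| * e.
Proof.
move=> df; rewrite (derive_basis v df).
set p := 'D_(_) f u; set q := 'D_(_) f u => pe qe.
have le1 := ler_pM (normr_ge0 _) (normr_ge0 _) (norm_fst_le v) pe.
have le2 := ler_pM (normr_ge0 _) (normr_ge0 _) (norm_snd_le v) qe.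
have tri := ler_normD (v.1 *: p) (v.2 *: q).
by rewrite !normrZ in tri; exact: le_trans tri (lerD le1 le2).
Qed.

(** Continuity of the partial derivatives makes both of them at most 1/4 near
    a point where they vanish; the mean value theorem, applied to the two
    components, then gives the Lipschitz constant 1/4 + 1/4 for the sup norm. *)
Lemma flat_half_lipschitz (h : R * R -> R * R) (D : set (R * R)) u0 :
  open D -> D u0 -> Ck_on 1 D h -> (forall v, 'D_v h u0 = 0) ->
  exists2 r : R, 0 < r & forall u v, `|u - u0| <= r -> `|v - u0| <= r ->
    D u /\ `|h v - h u| <= 2^-1 * `|v - u|.
Proof.
have half (e : R) : 0 < e -> 0 < e / 2 < e by move=> e0; apply/andP; split; lra.
have conv (t a b e : R) : 0 <= t -> 0 <= 1 - t -> a <= e -> b <= e ->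
    (1 - t) * a + t * b <= e.
  by move=> t0 t1 /(ler_wpM2l t1) ? /(ler_wpM2l t0) ?; lra.
have quarters (N : R) : N * 4^-1 + N * 4^-1 <= 2^-1 * N by lra.
move=> oD Du0 [dh Dh] h0.
have small (w : R * R) : \forall u \near u0, `|'D_w h u| <= 4^-1.
  have /cvgrPdist_le := Dh w u0 Du0.
  move=> /(_ 4^-1); rewrite h0 invr_gt0 ltr0n => /(_ isT).
  by apply: filterS => u; rewrite sub0r normrN.
have nD : \forall u \near u0, D u := open_nbhs_nbhs (conj oD Du0).
have /nbhs_ballP[e /= e0 ballP] : \forall u \near u0,
    (`|'D_((1, 0) : R * R) h u| <= 4^-1 /\ `|'D_((0, 1) : R * R) h u| <= 4^-1) /\
    D u.
  exact: filterI (filterI (small _) (small _)) nD.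
have {}ballP u : `|u - u0| <= e / 2 ->
    [/\ `|'D_((1, 0) : R * R) h u| <= 4^-1,
        `|'D_((0, 1) : R * R) h u| <= 4^-1 & D u].
  move=> ue.
  have bu : ball u0 e u.
    by rewrite -ball_normE /= distrC (le_lt_trans ue) // (andP (half e e0)).2.
  by case: (ballP u bu) => -[h1 h2] Du; exact: (And3 h1 h2 Du).
exists (e / 2); first by case/andP: (half e e0).
move=> u v ur vr; have [_ _ Du] := ballP u ur; split=> //.
have seg (t : R) : 0 <= t <= 1 -> `|u + t *: (v - u) - u0| <= e / 2.
  move=> /andP[t0 t1]; have -> : u + t *: (v - u) - u0 =
      (1 - t) *: (u - u0) + t *: (v - u0).
    rewrite addrAC scalerBl scale1r -[RHS]addrA; congr (_ + _).
    by rewrite [RHS]addrC -scalerBr opprB addrA subrK.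
  rewrite (le_trans (ler_normD _ _)) // !normrZ !ger0_norm ?subr_ge0 //.
  by apply: conv => //; rewrite subr_ge0.
have dhp (t : R) : 0 <= t <= 1 ->
    `|'D_(v - u) h (u + t *: (v - u))| <= 2^-1 * `|v - u|.
  move=> /seg/ballP[h1 h2 Dt].
  exact: le_trans (derive_plane_le _ (dh _ Dt) h1 h2) (quarters _).
have comp (L : {linear (R * R)%type -> R}) : (forall z, `|L z| <= `|z|) ->
    `|L (h v - h u)| <= 2^-1 * `|v - u|.
  move=> Lle; have cL := @linear_plane_continuous _ L.
  have dL (t : R) : 0 <= t <= 1 -> differentiable (L \o h) (u + t *: (v - u)).
    move=> /seg/ballP[_ _ /dh dt]; apply: differentiable_comp => //.
    exact: linear_differentiable.
  have [t t01] := segment_MVT dL; rewrite subrKC /= -linearB => ->.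
  have [_ _ /dh dt] := ballP _ (seg t t01).
  rewrite derive_lincomp //; exact: le_trans (Lle _) (dhp t t01).
rewrite prod_normE ge_max; apply/andP; split.
- exact: (comp fst norm_fst_le).
- exact: (comp snd norm_snd_le).
Qed.

(** With [x = g y] and [x' = g z], one has
    [g z - g y - L (z - y) = - L (f x' - f x - df (x' - x))], and the bracket is
    [o(|x' - x|) = o(|z - y|)] thanks to the Lipschitz estimate on [g]. *)
Lemma is_diff_inverse (V W : normedModType R) (f : V -> W) (g : W -> V) (y : W)
    (L : {linear W -> V}) (C : R) :
  continuous L -> differentiable f (g y) -> cancel ('d f (g y)) L ->
  (\forall z \near y, f (g z) = z) ->
  (\forall z \near y, `|g z - g y| <= C * `|z - y|) ->
  is_diff y g L.
Proof.
move=> cL df dfK fgK gC.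
(* A positive majorant of [C], so that one can divide by it. *)
pose C' := `|C| + 1.
have C'0 : 0 < C' by rewrite ltr_wpDl.
have {}gC : \forall z \near y, `|g z - g y| <= C' * `|z - y|.
  apply: filterS gC => z zC; apply: le_trans zC _.
  by apply: ler_wpM2r => //; rewrite /C' (le_trans (ler_norm _)) // lerDl.
have gy : {for y, continuous g}.
  apply/cvgrPdist_lt => e e0.
  have ball_y : \forall z \near y, `|z - y| < e / C'.
    apply/nbhs_ballP; exists (e / C'); first exact: divr_gt0.
    by move=> z; rewrite -ball_normE /= distrC.
  apply: filterS2 gC ball_y => z zC zy; rewrite distrC.
  by rewrite (le_lt_trans zC) // mulrC -ltr_pdivlMr.
have [K K0 LK] := linear_lipschitz cL.
have approx e : 0 < e ->
    \forall z \near y, `|g z - g y - L (z - y)| <= e * `|z - y|.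
  move=> e0; have e'0 : 0 < e / (K * C') by rewrite divr_gt0 // mulr_gt0.
  have fgy := gy _ (differentiable_approx df e'0).
  have fgyy : f (g y) = y := nbhs_singleton fgK.
  apply: filterS3 fgK gC fgy => z fgz zC; rewrite /= fgz fgyy => appr.
  have -> : g z - g y - L (z - y) =
      L ('d f (g y) (g z - g y)) - L (z - y) by rewrite dfK.
  rewrite -(linearB L) -normrN -linearN opprB.
  apply: le_trans (LK _) _; rewrite -ler_pdivlMl //.
  apply: le_trans appr _.
  apply: le_trans (ler_wpM2l (ltW e'0) zC) _.
  rewrite mulrA le_eqVlt; apply/orP; left; apply/eqP.
  by rewrite [RHS]mulrA; congr (_ * _); field; rewrite !gt_eqF.
exact: is_diffI_approx cL approx.
Qed.

(** Since [L] inverts the differential at [u0], the map [h u = u - L (f u)] is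
    1/2-Lipschitz near [u0], which makes [L o f] expanding, hence [f] injective.
    For surjectivity, take [y] close to [f u0] and minimize [|L (y - f u)|] over a
    compact square: the Newton step [u' = u + L (y - f u)] stays in the square and
    at least halves this quantity, so the minimum is 0. *)
Lemma lipschitz_local_inverse (f : R * R -> R * R) (L : {linear (R * R)%type -> (R * R)%type})
    (D : set (R * R)) (u0 : R * R) :
  open D -> D u0 -> Ck_on 1 D f -> injective L -> cancel ('d f u0) L ->
  exists U V (g : R * R -> R * R) (C : R),
    [/\ open U /\ open V, U u0 /\ U `<=` D,
        forall u, U u -> V (f u) /\ g (f u) = u,
        forall y, V y -> U (g y) /\ f (g y) = y &
        forall y z, V y -> V z -> `|g y - g z| <= C * `|y - z| ].
Proof.
have absorb (a b c : R) : a <= b + c -> c <= 2^-1 * a -> a <= 2 * b by lra.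
have halves (a b c d r : R) :
  a <= b + c -> b < r / 2 -> c <= 2^-1 * d -> d <= r -> a <= r by lra.
have shift_stepE (a b c d e : R * R) : a + (b - c) - d = b - e + (a - c - (d - e)).
  by case: a b c d e => [a1 a2] [b1 b2] [c1 c2] [d1 d2] [e1 e2];
    congr pair; rewrite /=; ring.
have step_residualE (a b c q : R * R) : b - (a + (b - c) - q) = q - (a - c).
  by case: a b c q => [a1 a2] [b1 b2] [c1 c2] [q1 q2];
    congr pair; rewrite /=; ring.
have vanish (a : R) : a <= 2^-1 * a -> a <= 0 by lra.
move=> oD Du0 f1 injL dfK; have cL := @linear_plane_continuous _ L.
have [df Df] := f1.
pose h u := u - L (f u).
have h1 : Ck_on 1 D h.
  exact: Ck_onB oD (Ck_on_id 1 D) (Ck_on_lincomp oD cL f1).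
have h0 v : 'D_v h u0 = 0.
  have dLf : differentiable (L \o f) u0.
    by apply: differentiable_comp; [exact: df | exact: linear_differentiable].
  rewrite /h deriveB; [|exact: derivable_id | exact: diff_derivable].
  rewrite derive_id derive_lincomp //; last exact: df.
  by rewrite deriveE ?dfK ?subrr //; exact: df.
have [r r0 hlip] := flat_half_lipschitz oD Du0 h1 h0.
have hE u : L (f u) = u - h u by rewrite /h subKr.
have [K K0 LK] := linear_lipschitz cL.
have expand u v : `|u - u0| <= r -> `|v - u0| <= r ->
    `|u - v| <= 2 * `|L (f u) - L (f v)|.
  move=> ur vr; have [_ huv] := hlip v u vr ur.
  have uvE : u - v = (L (f u) - L (f v)) + (h u - h v).
    by rewrite !hE addrACA subrK -opprD subrK.
  have tri := ler_normD (L (f u) - L (f v)) (h u - h v).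
  by rewrite -uvE in tri; exact: absorb tri huv.
have finj u v : `|u - u0| <= r -> `|v - u0| <= r -> f u = f v -> u = v.
  move=> ur vr fuv; apply/eqP; rewrite -subr_eq0 -normr_le0.
  by have := expand u v ur vr; rewrite fuv subrr normr0 mulr0.
have u0r : `|u0 - u0| <= r by rewrite subrr normr0 ltW.
pose V := [set y : R * R | `|L (y - f u0)| < r / 2].
pose U := [set u : R * R | `|u - u0| < r] `&` f @^-1` V.
have small u : `|u - u0| <= r -> V (f u) -> `|u - u0| < r.
  move=> ur; rewrite /V /= (linearB L) => Vu.
  apply: le_lt_trans (expand u u0 ur u0r) _.
  by rewrite mulrC -ltr_pdivlMr.
have surj y : V y -> exists2 u, U u & f u = y.
  move=> Vy.
  have cphi : {in [set u : R * R | `|u - u0| <= r],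
      continuous (fun u => `|L (y - f u)| : R)}.
    move=> u; rewrite inE /= => ur; have [Du _] := hlip u u ur ur.
    have cfu : {for u, continuous f} by exact/differentiable_continuous/df.
    have cyf : (fun v => y - f v) @ u --> y - f u.
      by apply: cvgB; [exact: cvg_cst | exact: cfu].
    exact: cvg_norm (cvg_comp _ _ cyf (cL _)).
  have ne : [set u : R * R | `|u - u0| <= r] !=set0.
    by exists u0; rewrite /= subrr normr0 ltW.
  have [u] := compact_EVT_min ne (@closed_square_compact u0 r)
    (continuous_in_subspaceT cphi).
  rewrite inE /= => ur umin.
  (* The Newton step, with the differential frozen at [u0]. *)
  pose u' := u + L (y - f u).
  have u'r : `|u' - u0| <= r.
    have u'E : u' - u0 = L (y - f u0) + (h u - h u0).
      by rewrite /u' !(linearB L); exact: (shift_stepE u (L y) (L (f u)) u0 (L (f u0))).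
    have [_ hu] := hlip u0 u u0r ur.
    have tri := ler_normD (L (y - f u0)) (h u - h u0); rewrite -u'E in tri.
    exact: halves tri Vy hu ur.
  have := umin u'; rewrite inE /= => /(_ u'r).
  have -> : L (y - f u') = h u' - h u.
    rewrite (linearB L) hE; have -> : h u = u - L (f u) by [].
    by rewrite {1}/u' (linearB L); exact: step_residualE.
  have [_ hu'] := hlip u u' ur u'r.
  move=> le1; have := le_trans le1 hu'.
  have -> : u' - u = L (y - f u) by rewrite /u' addrC addKr.
  move=> le2.
  have fy : f u = y.
    apply/injL; apply/eqP; rewrite eq_sym -subr_eq0 -(linearB L) -normr_le0.
    exact: vanish.
  by exists u => //; split; rewrite /= ?fy //; apply: small; rewrite ?fy.
pose g y := xget u0 [set u | U u /\ f u = y].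
have gP y : V y -> U (g y) /\ f (g y) = y.
  move=> /surj[u Uu fu].
  by apply: (@xgetPex _ u0 [set u | U u /\ f u = y]); exists u.
have UD : U `<=` D.
  by move=> u [/ltW ur _]; have [] := hlip u u ur ur.
have oV : open V.
  rewrite openE => y Vy; have cy : (fun z => `|L (z - f u0)|) @ y --> `|L (y - f u0)|.
    have cyf : (fun z => z - f u0) @ y --> y - f u0.
      by apply: cvgB; [exact: cvg_id | exact: cvg_cst].
    exact: cvg_norm (cvg_comp _ _ cyf (cL _)).
  exact: cvgr_lt cy _ Vy.
have oU : open U.
  rewrite openE => u Uu; have [ur Vu] := Uu; apply: filterI.
    have cu : (fun z => `|z - u0|) @ u --> `|u - u0|.
      by apply: cvg_norm; apply: cvgB; [exact: cvg_id | exact: cvg_cst].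
    exact: cvgr_lt cu _ ur.
  have cfu : {for u, continuous f} by exact/differentiable_continuous/df/UD.
  exact: cfu _ (open_nbhs_nbhs (conj oV Vu)).
exists U, V, g, (2 * K); split.
- by [].
- split=> //; split; rewrite /V /= subrr ?normr0 ?linear0 ?normr0 // divr_gt0 //.
- move=> u Uu; have [ur Vfu] := Uu; split=> //.
  have [[gr _] fg] := gP _ Vfu; apply: finj => //; exact: ltW.
- exact: gP.
- move=> y z Vy Vz; have [[yr _] fy] := gP y Vy; have [[zr _] fz] := gP z Vz.
  have := expand _ _ (ltW yr) (ltW zr); rewrite fy fz -(linearB L) => le1.
  by apply: le_trans le1 _; rewrite -mulrA; apply: ler_wpM2l.
Qed.

Lemma Ck_on_jacobian k (D : set (R * R)) (f : R * R -> R * R) :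
  open D -> Ck_on k.+1 D f -> Ck_on k D (Defs.jacobian f).
Proof.
move=> oD [_ Df].
have cfst := @linear_plane_continuous R fst.
have csnd := @linear_plane_continuous R snd.
have f1 v : Ck_on k D (fun u => ('D_v f u).1) := Ck_on_lincomp oD cfst (Df v).
have f2 v : Ck_on k D (fun u => ('D_v f u).2) := Ck_on_lincomp oD csnd (Df v).
exact: Ck_onB oD (Ck_onM oD (f1 _) (f2 _)) (Ck_onM oD (f2 _) (f1 _)).
Qed.

(** The differential of the inverse at [y] is given by Cramer's rule from the
    partial derivatives of [f] at [g y].  If [g] is C^k, so is that expression,
    and [g] is C^(k+1). *)
Lemma inverse_function (f : R * R -> R * R) (D : set (R * R)) (u0 : R * R) :
  open D -> D u0 -> smooth_on D f -> Defs.jacobian f u0 != 0 ->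
  exists U V (g : R * R -> R * R),
    [/\ open U /\ open V, U u0 /\ U `<=` D,
        forall u, U u -> V (f u) /\ g (f u) = u,
        forall y, V y -> U (g y) /\ f (g y) = y &
        smooth_on V g].
Proof.
move=> oD Du0 fsm J0.
(* On [D'] the differential is invertible at every point, not just at [u0]. *)
pose D' := D `&` [set u | Defs.jacobian f u != 0].
have oD' : open D'.
  rewrite openE => u [Du Ju]; apply: filterI; first exact: open_nbhs_nbhs (conj oD Du).
  have cJ : {for u, continuous (Defs.jacobian f)} := Ck_on_jacobian oD (fsm 1%N) u Du.
  exact: cJ _ (open_nbhs_nbhs (conj (@open_neq R 0) Ju)).
have D'D : D' `<=` D by move=> u [].
have fsm' k : Ck_on k D' f := Ck_on_sub D'D (fsm k).
pose Dinv u := inv2 ('D_((1, 0) : R * R) f u) ('D_((0, 1) : R * R) f u).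
have dfK u : D' u -> cancel ('d f u) (Dinv u).
  move=> [Du Ju] v; have [df _] := fsm 1.
  rewrite -deriveE; last exact: df.
  by rewrite derive_basis; [exact: inv2K | exact: df].
have [||| U [V [g [C [oUV UU fU gV gC]]]]] :=
  @lipschitz_local_inverse f (Dinv u0) D' u0 oD' _ (fsm' 1).
- by [].
- exact: inv2_inj.
- exact: dfK.
have [oU oV] := oUV; have [Uu0 UD'] := UU.
have dg y : V y -> is_diff y g (Dinv (g y)).
  move=> Vy; have nV : \forall z \near y, V z := open_nbhs_nbhs (conj oV Vy).
  have [Ugy fgy] := gV y Vy; have [df _] := fsm' 1.
  apply: (@is_diff_inverse _ _ f g y (Dinv (g y)) C).
  - exact: linear_plane_continuous.
  - exact/df/UD'.
  - exact/dfK/UD'.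
  - by apply: filterS nV => z /gV[].
  - by apply: filterS nV => z Vz; exact: gC.
exists U, V, g; split=> //.
  by split=> // u /UD'[].
move=> k; elim: k => [|k IH].
  by move=> y Vy; apply: differentiable_continuous; have [] := dg y Vy.
split=> [y Vy|v]; first by have [] := dg y Vy.
have Dinvv : Ck_on k D' (fun u => Dinv u v).
  have [_ Df] := fsm' k.+1.
  have cfst := @linear_plane_continuous R fst.
  have csnd := @linear_plane_continuous R snd.
  have f1 w : Ck_on k D' (fun u => ('D_w f u).1) := Ck_on_lincomp oD' cfst (Df w).
  have f2 w : Ck_on k D' (fun u => ('D_w f u).2) := Ck_on_lincomp oD' csnd (Df w).
  have cst a : Ck_on k D' (fun _ => a : R) := Ck_on_cst k D' a.
  have JV : Ck_on k D' (fun u => (Defs.jacobian f u)^-1).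
    apply: (Ck_on_inv oD' _ (Ck_on_jacobian oD' (fsm' k.+1))).
    by move=> u [].
  apply: (Ck_on_pair oD'); apply: (Ck_onM oD' JV); apply: (Ck_onB oD');
    apply: (Ck_onM oD'); [exact: f2|exact: cst|exact: f1|exact: cst
                         |exact: f1|exact: cst|exact: f2|exact: cst].
have VD' y : V y -> D' (g y) by move=> /gV[/UD'].
apply: Ck_on_ext oV _ (Ck_on_comp oV VD' IH Dinvv) => y Vy.
by rewrite (is_diff_derive v (dg y Vy)).
Qed.

End Plane.

(** * The Minkowski form *)

Section MinkowskiForm.
Context {R : realType}.
Implicit Types u v w : 'rV[R]_4.

Lemma minkC u v : mink u v = mink v u.
Proof. by rewrite /mink mulrC; congr (_ - _); apply: eq_bigr => i _; rewrite mulrC. Qed.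

Lemma mink_linear w : linear (mink ^~ w).
Proof.
move=> t u v; rewrite /mink /GRing.scale /= mulrBr mulr_sumr.
rewrite addrACA -opprD -big_split /=; congr (_ - _).
  by apply: eq_bigr => i _; rewrite !mxE mulrDl mulrA.
by rewrite !mxE mulrDl mulrA.
Qed.

Lemma mink_linear_r w : linear (mink w).
Proof. by move=> t u v; rewrite !(minkC w) mink_linear. Qed.

Lemma minkDl u v w : mink (u + v) w = mink u w + mink v w.
Proof. by have := mink_linear w 1 u v; rewrite !scale1r. Qed.

Lemma mink0l w : mink 0 w = 0.
Proof. by apply: (addrI (mink 0 w)); rewrite -minkDl !addr0. Qed.

Lemma minkZl t u w : mink (t *: u) w = t * mink u w.
Proof. by have := mink_linear w t u 0; rewrite addr0 mink0l addr0. Qed.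

Lemma minkNl u w : mink (- u) w = - mink u w.
Proof. by rewrite -scaleN1r minkZl mulN1r. Qed.

Lemma minkBl u v w : mink (u - v) w = mink u w - mink v w.
Proof. by rewrite minkDl minkNl. Qed.

Lemma minkDr u v w : mink w (u + v) = mink w u + mink w v.
Proof. by rewrite !(minkC w) minkDl. Qed.

Lemma minkBr u v w : mink w (u - v) = mink w u - mink w v.
Proof. by rewrite !(minkC w) minkBl. Qed.

Lemma minkZr t u w : mink w (t *: u) = t * mink w u.
Proof. by rewrite !(minkC w) minkZl. Qed.

Lemma mink_continuous :
  continuous (fun p : 'rV[R]_4 * 'rV[R]_4 => mink p.1 p.2).
Proof.
have ccoord i : continuous (fun v : 'rV[R]_4 => v 0 i) by exact: coord_continuous.
have cprod i : continuous (fun p : 'rV[R]_4 * 'rV[R]_4 => p.1 0 i * p.2 0 i).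
  move=> p; apply: cvgM.
    by apply: (@cvg_comp _ _ _ fst (fun v : 'rV[R]_4 => v 0 i) _ (nbhs p.1));
      [exact: cvg_fst | exact: ccoord].
  by apply: (@cvg_comp _ _ _ snd (fun v : 'rV[R]_4 => v 0 i) _ (nbhs p.2));
    [exact: cvg_snd | exact: ccoord].
move=> p; apply: cvgB; last exact: cprod.
by apply: cvg_big => // *; [exact: add_continuous|exact: cprod].
Qed.

Lemma is_diff_mink (V : normedModType R) (f g df dg : V -> 'rV[R]_4) (x : V) :
  is_diff x f df -> is_diff x g dg ->
  is_diff x (fun y => mink (f y) (g y))
    (fun z => mink (f x) (dg z) + mink (df z) (g x)).
Proof.
move=> fx gx.
have bil : bilinear_for (GRing.Scale.Law.clone _ _ *:%R _)
    (GRing.Scale.Law.clone _ _ *:%R _) (@mink R).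
  by split=> [u' | u] a y z /=; [exact: mink_linear|exact: mink_linear_r].
pose mkM := bilinear_isBilinear.Build R 'rV[R]_4 'rV[R]_4 R _ _ _ bil.
pose mk : {bilinear 'rV[R]_4 -> 'rV[R]_4 -> R} := HB.pack (@mink R) mkM.
have mkcont : continuous (fun p : 'rV[R]_4 * 'rV[R]_4 => mk p.1 p.2).
  exact: mink_continuous.
have mkdiff : is_diff (f x, g x) (fun p : 'rV[R]_4 * 'rV[R]_4 => mink p.1 p.2)
    (fun q => mink (f x) q.2 + mink q.1 (g x)).
  apply: DiffDef; first exact: (differentiable_bilin (f x, g x) mkcont).
  exact: (diff_bilin (f x, g x) mkcont).
exact: (@is_diff_comp _ _ _ _ (fun y => (f y, g y)) (fun z => (df z, dg z))
  (fun p : 'rV[R]_4 * 'rV[R]_4 => mink p.1 p.2)).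
Qed.

Lemma derive_mink (V : normedModType R) (f g : V -> 'rV[R]_4) (x v : V) :
  differentiable f x -> differentiable g x ->
  'D_v (fun y => mink (f y) (g y)) x = mink (f x) ('D_v g x) + mink ('D_v f x) (g x).
Proof.
move=> /differentiable_derive df /differentiable_derive dg.
exact: (is_diff_derive v (is_diff_mink df dg)).
Qed.

HB.instance Definition _ w :=
  GRing.isLinear.Build R 'rV[R]_4 R _ (mink w) (mink_linear_r w).

Lemma mink_r_continuous w : continuous (mink w).
Proof.
move=> v; apply: differentiable_continuous.
by have [] := is_diff_mink (is_diff_cst w v) (is_diff_id v).
Qed.

Lemma parallel_const (Z : 'rV[R]_4 -> 'rV[R]_4) : parallel Z ->
  forall x y, Z x = Z y.
Proof.
move=> pZ x y; rewrite -(subrKC x y); symmetry; apply: segment_derive_eq0_const.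
by move=> t _; have [] := pZ (x + t *: (y - x)).
Qed.

End MinkowskiForm.

(** * Charts and transition maps *)

Section Charts.
Context {R : realType} {M : topologicalType}.
Implicit Types c : chart R M.

Lemma par_coord c p : is_chart c -> chart_patch c p ->
  dom c (Defs.coord c p) /\ par c (Defs.coord c p) = p.
Proof. by move=> [_ _ cpK _ _] [u Du <-]; rewrite cpK. Qed.

(** The set is the preimage of [O] under the continuous inverse [coord c],
    inside the open patch. *)
Lemma chart_open_image c (O : set (R * R)) : is_chart c -> open O ->
  O `<=` dom c -> open (par c @` O).
Proof.
move=> chc oO OD; have [oD oP cpK cpar ccoord] := chc.
rewrite openE => _ [u Ou <-].
have Pu : chart_patch c (par c u) by exists u => //; exact: OD.
have nO : \forall q \near par c u, O (Defs.coord c q).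
  by apply: ccoord Pu _ _; rewrite cpK; [exact: open_nbhs_nbhs|exact: OD].
have nP : \forall q \near par c u, chart_patch c q.
  exact: open_nbhs_nbhs (conj oP Pu).
apply: filterS2 nO nP => q Oq /(par_coord chc)[_ pq].
by exists (Defs.coord c q).
Qed.

Lemma overlap_open c1 c2 : is_chart c1 -> is_chart c2 -> open (overlap c1 c2).
Proof.
move=> [oD _ _ cpar _] [_ oP _ _ _]; rewrite openE => u [Du Pu].
apply: filterI; first exact: open_nbhs_nbhs (conj oD Du).
exact: cpar Du _ (open_nbhs_nbhs (conj oP Pu)).
Qed.

Lemma par_transition c1 c2 u : is_chart c2 -> overlap c1 c2 u ->
  dom c2 (transition c1 c2 u) /\ par c2 (transition c1 c2 u) = par c1 u.
Proof. by move=> ch2 [_ /(par_coord ch2)]. Qed.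

End Charts.

(** * Differentials of maps on an immersed surface *)

Section Immersions.
Context {R : realType} {M : topologicalType}.
Variables (A : set (chart R M)) (phi : M -> 'rV[R]_4).
Hypotheses (atlasA : oriented_atlas A) (immA : immersion A phi).

Let chA c : A c -> is_chart c.
Proof. by have [+ _ _ _] := atlasA; exact. Qed.

Lemma smooth_map_differentiable (V : normedModType R) (g : M -> V) c u :
  smooth_map A g -> A c -> dom c u -> differentiable (g \o par c) u.
Proof. by move=> sg Ac; have [+ _] := sg c Ac 1; exact. Qed.

Lemma transition_differentiable c1 c2 u :
  A c1 -> A c2 -> overlap c1 c2 u -> differentiable (transition c1 c2) u.
Proof.
move=> A1 A2; have [_ _ + _] := atlasA.
by move=> /(_ c1 c2 A1 A2)[/(_ 1)[+ _] _]; exact.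
Qed.

Lemma derive_chart_change (V : normedModType R) (g : M -> V) c1 c2 u xi :
  smooth_map A g -> A c1 -> A c2 -> overlap c1 c2 u ->
  'D_xi (g \o par c1) u =
  'D_('D_xi (transition c1 c2) u) (g \o par c2) (transition c1 c2 u).
Proof.
move=> sg A1 A2 ou; have [du pu] := par_transition (chA A2) ou.
rewrite -derive_comp; first last.
- exact: smooth_map_differentiable.
- exact: transition_differentiable.
apply: near_eq_derive.
have nov := open_nbhs_nbhs (conj (overlap_open (chA A1) (chA A2)) ou).
by apply: filterS nov => z oz /=; have [_ ->] := par_transition (chA A2) oz.
Qed.

(** If two charts represent the same vector [v], the differential of the
    transition map carries one coordinate vector to the other: both have image
    [v] under the differential of [phi], which is injective. *)
Lemma represents_derive (V : normedModType R) (g : M -> V) c1 c2 u1 u2 xi1 xi2 p v :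
  smooth_map A g ->
  represents A phi c1 u1 xi1 p v -> represents A phi c2 u2 xi2 p v ->
  'D_xi1 (g \o par c1) u1 = 'D_xi2 (g \o par c2) u2.
Proof.
move=> sg [A1 D1 p1 v1] [A2 D2 p2 v2]; have [sphi inj] := immA.
have ou : overlap c1 c2 u1 by split=> //; exists u2; rewrite // p1 p2.
have tu : transition c1 c2 u1 = u2.
  by rewrite /transition /= p1 -p2; have [_ _ -> ] := chA A2.
rewrite (derive_chart_change _ sg A1 A2 ou) tu.
congr ('D__ _ _); apply/eqP; rewrite -subr_eq0; apply/eqP.
apply: (inj c2 u2 _ A2 D2); rewrite -scaleN1r addrC.
rewrite derive_linear; last exact: smooth_map_differentiable.
move: v1; rewrite (derive_chart_change _ sphi A1 A2 ou) tu => ->.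
by rewrite v2 scaleN1r addNr.
Qed.

(** The choice made in the definition of [dmap] is harmless: any
    representative of [v] computes it. *)
Lemma dmapE (V : normedModType R) (g : M -> V) c u xi p v :
  smooth_map A g -> represents A phi c u xi p v ->
  dmap A phi g p v = 'D_xi (g \o par c) u.
Proof.
move=> sg rep; rewrite /dmap; set S := [set w | _].
have [c' [u' [xi' [rep' ->]]]] : S (xget 0 S).
  by apply: (xgetPex 0); exists ('D_xi (g \o par c) u), c, u, xi.
exact: represents_derive sg rep' rep.
Qed.

Lemma tangent_represents c u p v :
  A c -> dom c u -> par c u = p -> tangent A phi p v ->
  exists xi, represents A phi c u xi p v.
Proof.
move=> Ac Du pu [c' [u' [xi' [Ac' Du' pu' vE]]]].
have ou : overlap c' c u' by split=> //; exists u; rewrite // pu pu'.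
have tu : transition c' c u' = u.
  by rewrite /transition /= pu' -pu; have [_ _ -> ] := chA Ac.
exists ('D_xi' (transition c' c) u'); split=> //.
have [sphi _] := immA.
by rewrite -vE (derive_chart_change _ sphi Ac' Ac ou) tu.
Qed.

Lemma tangent_linear p v w (t : R) :
  tangent A phi p v -> tangent A phi p w -> tangent A phi p (t *: v + w).
Proof.
move=> [c [u [xi [Ac Du pu vE]]]] /(tangent_represents Ac Du pu)[eta [_ _ _ wE]].
have [sphi _] := immA.
exists c, u, (t *: xi + eta); split=> //.
by rewrite derive_linear ?vE ?wE //; exact: smooth_map_differentiable.
Qed.

End Immersions.

(** * The tangent part of the parallel field is constant *)

Section ConstantTangentPart.
Context {R : realType} {M : topologicalType}.
Variables (A : set (chart R M)) (phi : M -> 'rV[R]_4).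
Hypotheses (atlasA : oriented_atlas A) (immA : immersion A phi).

Let open_dom c : A c -> open (dom c).
Proof. by have [chA _ _ _] := atlasA => /chA[]. Qed.

Lemma smooth_map_mink (g : M -> 'rV[R]_4) w :
  smooth_map A g -> smooth_map A (fun q => mink w (g q)).
Proof.
move=> sg c Ac k; apply: Ck_on_lincomp (sg c Ac k); first exact: open_dom.
exact: mink_r_continuous.
Qed.

(** Differentials commute with the linear forms [mink w]; this is how the
    scalar formulation of torsion in [levi_civita] is applied to vector fields. *)
Lemma dmap_mink (g : M -> 'rV[R]_4) w p v :
  smooth_map A g -> tangent A phi p v ->
  dmap A phi (fun q => mink w (g q)) p v = mink w (dmap A phi g p v).
Proof.
move=> sg [c [u [xi rep]]].
rewrite !(dmapE atlasA immA _ rep) //; last exact: smooth_map_mink.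
have [Ac Du _ _] := rep.
apply: derive_lincomp; first exact: mink_r_continuous.
exact: smooth_map_differentiable sg Ac Du.
Qed.

Lemma dmap_phi p v : tangent A phi p v -> dmap A phi phi p v = v.
Proof.
move=> [c [u [xi rep]]]; have [sphi _] := immA.
by rewrite (dmapE atlasA immA sphi rep); case: rep.
Qed.

Lemma dmap_linear (V : normedModType R) (g : M -> V) p v w (t : R) :
  smooth_map A g -> tangent A phi p v -> tangent A phi p w ->
  dmap A phi g p (t *: v + w) = t *: dmap A phi g p v + dmap A phi g p w.
Proof.
move=> sg [c [u [xi rv]]] tw; have [Ac Du pu vE] := rv.
have [eta rw] := tangent_represents atlasA immA Ac Du pu tw.
have [sphi _] := immA.
have rvw : represents A phi c u (t *: xi + eta) p (t *: v + w).
  split=> //; have [_ _ _ wE] := rw.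
  by rewrite derive_linear ?vE ?wE //; exact: smooth_map_differentiable sphi Ac Du.
rewrite (dmapE atlasA immA sg rv) (dmapE atlasA immA sg rw).
rewrite (dmapE atlasA immA sg rvw) derive_linear //.
exact: smooth_map_differentiable sg Ac Du.
Qed.

(** The level sets are open, because the map is constant along the segments
    of a ball in a chart; hence they are also closed. *)
Lemma dmap_eq0_constant (g : M -> 'rV[R]_4) : connected [set: M] ->
  smooth_map A g ->
  (forall p v, tangent A phi p v -> dmap A phi g p v = 0) ->
  forall p q, g p = g q.
Proof.
move=> connM sg g0; have [chA cover _ _] := atlasA.
have locconst p : \forall q \near p, g q = g p.
  have [c Ac Pp] := cover p; have chc := chA c Ac.
  have [Du pu] := par_coord chc Pp; set u := Defs.coord c p in Du pu.
  have [e /= e0 eD] : nbhs_ball u (dom c).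
    by apply/nbhs_ballP; exact: open_nbhs_nbhs (conj (open_dom Ac) Du).
  have oB : open (par c @` ball u e).
    by apply: chart_open_image => //; exact: ball_open.
  have Bp : (par c @` ball u e) p by exists u => //; exact: ballxx.
  apply: filterS (open_nbhs_nbhs (conj oB Bp)) => _ [z uz <-].
  rewrite -pu -[z](subrKC u).
  apply: (@segment_derive_eq0_const _ _ _ _ (g \o par c)) => t /andP[t0 t1].
  have Dt : dom c (u + t *: (z - u)).
    apply: eD; rewrite -ball_normE /= opprD addNKr normrN normrZ ger0_norm //.
    apply: le_lt_trans (_ : `|z - u| < e); first exact: ler_piMl.
    by move: uz; rewrite -ball_normE /= distrC.
  split; first exact: smooth_map_differentiable sg Ac Dt.
  have rep : represents A phi c (u + t *: (z - u)) (z - u)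
    (par c (u + t *: (z - u))) ('D_(z - u) (phi \o par c) (u + t *: (z - u))).
    by split.
  rewrite -(dmapE atlasA immA sg rep) g0 //.
  by exists c, (u + t *: (z - u)), (z - u).
move=> p q; pose S := [set r | g r = g q].
suff SE : S = [set: M] by have : S p by rewrite SE.
apply: connM; first by exists q.
- exists S; last by rewrite setTI.
  by rewrite openE => r Sr; apply: filterS (locconst r) => z; rewrite /S /= => ->.
- exists S; last by rewrite setTI.
  rewrite -openC openE => r Sr; apply: filterS (locconst r) => z.
  by rewrite /S /= => ->.
Qed.

Variables (z0 : 'rV[R]_4) (ZT ZN W : M -> 'rV[R]_4).
Variable nabla : (M -> 'rV[R]_4) -> (M -> 'rV[R]_4) -> (M -> 'rV[R]_4).
Hypotheses (tanZT : tangent_field A phi ZT) (norZN : normal_field A phi ZN).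
Hypotheses (z0E : forall p, z0 = ZT p + ZN p) (z0_unit : mink z0 z0 = 1).
Hypothesis nullZN : forall p, mink (ZN p) (ZN p) = 0.
Hypothesis orW : oriented_unit_normal_to A phi ZT W.
Hypothesis LC : levi_civita A phi nabla.
Hypothesis WW0 : forall p, mink (second_ff A phi nabla W W p) (ZN p) = 0.
Hypothesis ZT0 : forall X, tangent_field A phi X ->
  forall p, second_ff A phi nabla X ZT p = 0.

Let tanW : tangent_field A phi W := orW.1.

Lemma tangent_part_unit p : mink (ZT p) (ZT p) = 1.
Proof.
have n0 : mink (ZN p) (ZT p) = 0 by apply: norZN.2; exact: tanZT.2.
rewrite -z0_unit {1}(z0E p) [in RHS](z0E p) minkDl !minkDr.
by rewrite nullZN n0 (minkC (ZT p)) n0 !addr0.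
Qed.

(** The orientation hypothesis says in particular that [ZT p] and [W p] are
    linearly independent; orthonormality identifies the coefficients. *)
Lemma tangent_frame p v : tangent A phi p v ->
  v = mink v (ZT p) *: ZT p + mink v (W p) *: W p.
Proof.
move=> tv; have [W1 ZTW0 [c [u [xi [eta [rxi reta det]]]]]] := orW.2 p.
have [Ac Du pu xiE] := rxi; have [_ _ _ etaE] := reta.
have [zeta [_ _ _ zetaE]] := tangent_represents atlasA immA Ac Du pu tv.
have [sphi _] := immA; have dphi := smooth_map_differentiable sphi Ac Du.
have [s [t vE]] : exists s t, v = s *: ZT p + t *: W p.
  pose d := xi.1 * eta.2 - xi.2 * eta.1.
  exists ((zeta.1 * eta.2 - zeta.2 * eta.1) / d).
  exists ((xi.1 * zeta.2 - xi.2 * zeta.1) / d).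
  rewrite -zetaE -xiE -etaE -[X in _ = _ + X]addr0 -(derive0 (phi \o par c) u).
  rewrite -!derive_linear //; congr ('D__ _ _).
  move: det @d; case: xi {rxi xiE} => x1 x2; case: eta {reta etaE} => y1 y2.
  case: zeta {zetaE} => z1 z2 /= det.
  have d0 : x1 * y2 - x2 * y1 != 0 by rewrite gt_eqF.
  by congr pair; rewrite /= /GRing.scale /=; field.
rewrite {1}vE; congr (_ *: _ + _ *: _); rewrite vE minkDl !minkZl.
  by rewrite tangent_part_unit (minkC (W p)) ZTW0; ring.
by rewrite W1 ZTW0; ring.
Qed.

Lemma dZT_orthogonal_ZT p v : tangent A phi p v ->
  mink (dmap A phi ZT p v) (ZT p) = 0.
Proof.
move=> [c [u [xi rep]]]; have [Ac Du pu _] := rep.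
rewrite (dmapE atlasA immA tanZT.1 rep).
have dZT := smooth_map_differentiable tanZT.1 Ac Du.
have := derive_mink xi dZT dZT.
rewrite (_ : (fun y => mink _ _) = cst 1); last first.
  by apply/funext => y; exact: tangent_part_unit.
rewrite derive_cst /= pu minkC => /esym/eqP.
by rewrite -mulr2n mulrn_eq0 /= => /eqP.
Qed.

(** Differentiate [<ZN, W> = 0], using [dZN = - dZT]. *)
Lemma mink_dZT_W p v : tangent A phi p v ->
  mink (dmap A phi ZT p v) (W p) = mink (ZN p) (dmap A phi W p v).
Proof.
move=> [c [u [xi rep]]]; have [Ac Du pu _] := rep.
rewrite (dmapE atlasA immA tanZT.1 rep) (dmapE atlasA immA tanW.1 rep).
have dZT := smooth_map_differentiable tanZT.1 Ac Du.
have dW := smooth_map_differentiable tanW.1 Ac Du.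
have dZN := smooth_map_differentiable norZN.1 Ac Du.
have DN : 'D_xi (ZN \o par c) u = - 'D_xi (ZT \o par c) u.
  have -> : ZN \o par c = cst z0 - (ZT \o par c).
    by apply/funext => y; rewrite !fctE /= (z0E (par c y)) addrAC subrr add0r.
  rewrite deriveB; [|exact: derivable_cst|exact: diff_derivable].
  by rewrite derive_cst sub0r.
have := derive_mink xi dZN dW.
rewrite (_ : (fun y => mink _ _) = cst 0); last first.
  by apply/funext => y; apply: norZN.2; exact: tanW.2.
rewrite derive_cst DN minkNl /= pu.
by move=> /esym/eqP; rewrite subr_eq0 => /eqP.
Qed.

(** The normal component of [dZT(X)] is [B(X, ZT)]. *)
Lemma dZT_tangent X p : tangent_field A phi X ->
  tangent A phi p (dmap A phi ZT p (X p)).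
Proof.
move=> tanX; have /eqP := ZT0 tanX p; rewrite subr_eq0 => /eqP ->.
by apply: (LC.1 X ZT tanX tanZT).2.
Qed.

(** [dW(ZT) - dZT(W)] is the Lie bracket of [ZT] and [W], hence tangent and
    orthogonal to [ZN p].  In terms of the connection: it has the same scalar
    product with [ZN p] as [nabla_ZT W - nabla_W ZT], which is seen by applying
    the torsion identity to the single function [<ZN p, phi>]. *)
Lemma mink_ZN_bracket p :
  mink (ZN p) (dmap A phi W p (ZT p)) = mink (ZN p) (dmap A phi ZT p (W p)).
Proof.
have [tannabla [_ [_ [_ [_ [torsion _]]]]]] := LC.
have [sphi _] := immA.
(* [p] is fixed here: [f] is a linear coordinate of the immersion. *)
pose f q := mink (ZN p) (phi q).
have df X q : tangent_field A phi X -> dmap A phi f q (X q) = mink (ZN p) (X q).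
  by move=> tanX; rewrite dmap_mink ?dmap_phi //; exact: tanX.2.
have := torsion ZT W f tanZT tanW (smooth_map_mink _ sphi) p.
have -> : (fun q => dmap A phi f q (W q)) = (fun q => mink (ZN p) (W q)).
  by apply/funext => q; exact: df.
have -> : (fun q => dmap A phi f q (ZT q)) = (fun q => mink (ZN p) (ZT q)).
  by apply/funext => q; exact: df.
have tanB : tangent A phi p (nabla ZT W p - nabla W ZT p).
  rewrite -scaleN1r addrC; apply: (tangent_linear atlasA immA).
    exact: (tannabla W ZT tanW tanZT).2.
  exact: (tannabla ZT W tanZT tanW).2.
rewrite (dmap_mink _ tanW.1 (tanZT.2 p)) (dmap_mink _ tanZT.1 (tanW.2 p)).
rewrite /f (dmap_mink _ sphi tanB) (dmap_phi tanB) (norZN.2 p _ tanB).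
by move=> /esym/eqP; rewrite subr_eq0 => /eqP.
Qed.

(** The direction [W] is treated first, since the direction [ZT] is reduced
    to it by the bracket identity. *)
Lemma dmap_tangent_part_eq0 p v : tangent A phi p v -> dmap A phi ZT p v = 0.
Proof.
have vanish X q : tangent_field A phi X ->
    mink (dmap A phi ZT q (X q)) (W q) = 0 -> dmap A phi ZT q (X q) = 0.
  move=> tanX m0; rewrite (tangent_frame (dZT_tangent q tanX)) m0.
  by rewrite dZT_orthogonal_ZT ?scale0r ?addr0 //; exact: tanX.2.
have dW0 q : mink (dmap A phi ZT q (W q)) (W q) = 0.
  rewrite mink_dZT_W; last exact: tanW.2.
  have := WW0 q; rewrite /second_ff minkBl !(minkC _ (ZN q)).
  rewrite [X in _ - X](norZN.2 q _ ((LC.1 W W tanW tanW).2 q)).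
  by rewrite subr0.
have ZT_dir : dmap A phi ZT p (ZT p) = 0.
  apply: (vanish) => //; rewrite mink_dZT_W; last exact: tanZT.2.
  by rewrite mink_ZN_bracket (vanish _ _ tanW (dW0 p)) minkC mink0l.
have W_dir : dmap A phi ZT p (W p) = 0 by exact: vanish.
(* [dmap_linear] speaks of [t *: v + w]; a lone [t *: W p] needs [w = 0]. *)
have tan0 : tangent A phi p 0.
  rewrite -[0](subrr (ZT p)) -scaleN1r addrC.
  by apply: (tangent_linear atlasA immA); exact: tanZT.2.
move=> tv; rewrite (tangent_frame tv) (dmap_linear _ tanZT.1 (tanZT.2 p)).
  rewrite ZT_dir scaler0 add0r -[X in dmap _ _ _ _ X]addr0.
  rewrite (dmap_linear _ tanZT.1 (tanW.2 p) tan0) W_dir scaler0 add0r.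
  rewrite -[X in dmap _ _ _ _ X](subrr (ZT p)) -scaleN1r addrC.
  rewrite (dmap_linear _ tanZT.1 (tanZT.2 p) (tanZT.2 p)) ZT_dir.
  by rewrite scaler0 addr0.
rewrite -[X in tangent _ _ _ X]addr0.
exact: (tangent_linear atlasA immA _ (tanW.2 p) tan0).
Qed.

End ConstantTangentPart.

(** * Charts with prescribed coordinate functions *)

Lemma open_square_ball (R : realType) (z : R * R) (e : R) :
  `]z.1 - e, z.1 + e[%classic `*` `]z.2 - e, z.2 + e[%classic = ball z e.
Proof.
have ballE (a x : R) : ball a e x <-> `]a - e, a + e[%classic x.
  by rewrite -ball_normE /= in_itv /= distrC ltr_distl.
apply/seteqP; split=> -[x y] [].
  by move=> /ballE xe /ballE ye; split.
by move=> /ballE xe /ballE ye; split.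
Qed.

(** The determinants of two mutually inverse matrices have product 1. *)
Lemma jacobian_neq0 (R : realType) (f : R * R -> R * R) (u xi eta : R * R) :
  differentiable f u -> 'D_xi f u = (1, 0) -> 'D_eta f u = (0, 1) ->
  Defs.jacobian f u != 0.
Proof.
move=> df; rewrite (derive_basis xi df) (derive_basis eta df) /Defs.jacobian.
case: ('D_((1, 0) : R * R) f u) ('D_((0, 1) : R * R) f u) => a b [c d].
case: xi eta => [x1 x2] [y1 y2] /= [xac xbd] [yac ybd]; apply/eqP => J0.
have : (x1 * a + x2 * c) * (y1 * b + y2 * d) -
    (x1 * b + x2 * d) * (y1 * a + y2 * c) = (x1 * y2 - x2 * y1) * (a * d - b * c).
  by ring.
rewrite J0 mulr0 -[x1 * a]/(x1 *: a) -[x2 * c]/(x2 *: c); apply/eqP.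
move: xac xbd yac ybd; rewrite /GRing.scale /= => -> -> -> ->.
by rewrite mul1r mul0r subr0 oner_eq0.
Qed.

Lemma segment_itv (R : realType) (a b x y t : R) :
  a < x < b -> a < y < b -> 0 <= t <= 1 -> a < x + t * (y - x) < b.
Proof.
move=> /andP[ax xb] /andP[ay yb] /andP[t0 t1]; have [xy|/ltW yx] := leP x y.
- have := mulr_ge0 t0 (_ : 0 <= y - x); have := ler_piMl (_ : 0 <= y - x) t1.
  by rewrite subr_ge0 => /(_ xy) ? /(_ xy) ?; apply/andP; split; lra.
- have := mulr_ge0 t0 (_ : 0 <= x - y); have := ler_piMl (_ : 0 <= x - y) t1.
  by rewrite subr_ge0 => /(_ yx) ? /(_ yx) ?; apply/andP; split; lra.
Qed.

Section AdaptedCharts.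
Context {R : realType} {M : topologicalType}.
Variables (A : set (chart R M)) (phi : M -> 'rV[R]_4).
Hypotheses (atlasA : oriented_atlas A) (immA : immersion A phi).

Let chA c : A c -> is_chart c.
Proof. by have [+ _ _ _] := atlasA; exact. Qed.

Let sphi : smooth_map A phi := immA.1.

Lemma smooth_map_continuous (V : normedModType R) (g : M -> V) :
  smooth_map A g -> continuous g.
Proof.
move=> sg p; have [_ cover _ _] := atlasA; have [c Ac Pp] := cover p.
have [_ oP _ _ ccoord] := chA Ac; have [Du pu] := par_coord (chA Ac) Pp.
have cgp : {for Defs.coord c p, continuous (g \o par c)}.
  exact/differentiable_continuous/(smooth_map_differentiable sg Ac Du).
have nP : \forall q \near p, g q = (g \o par c) (Defs.coord c q).
  apply: filterS (open_nbhs_nbhs (conj oP Pp)) => q /(par_coord (chA Ac))[_ qE].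
  by rewrite /= qE.
have cc : (g \o par c \o Defs.coord c) @ p --> g p.
  rewrite -[g p]/(g p) -{2}pu; apply: cvg_comp (ccoord p Pp) cgp.
apply: cvg_trans cc; apply: near_eq_cvg.
by apply: filterS nP => q qE; rewrite qE.
Qed.

Lemma smooth_map_pair (U V : normedModType R) (f : M -> U) (g : M -> V) :
  smooth_map A f -> smooth_map A g -> smooth_map A (fun q => (f q, g q)).
Proof.
move=> sf sg c Ac k; have [oD _ _ _ _] := chA Ac.
exact: Ck_on_pair oD (sf c Ac k) (sg c Ac k).
Qed.

(** Precompose [par c0] with the local inverse of [F o par c0].  The new
    coordinate map is [F] itself, so compatibility in one direction is the
    smoothness of [F], and in the other that of the local inverse. *)
Lemma chart_of_coordinates (F : M -> R * R) c0 p :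
  smooth_map A F -> A c0 -> chart_patch c0 p ->
  Defs.jacobian (F \o par c0) (Defs.coord c0 p) != 0 ->
  exists e : R, 0 < e /\ exists c : chart R M,
    [/\ parametrization A c, chart_patch c p,
        dom c = `](F p).1 - e, (F p).1 + e[%classic `*`
                `](F p).2 - e, (F p).2 + e[%classic,
        Defs.coord c = F &
        forall (V : normedModType R) (g : M -> V), smooth_map A g ->
          smooth_on (dom c) (g \o par c)].
Proof.
move=> sF A0 Pp J0; have ch0 := chA A0; have [oD0 oP0 cK0 cpar0 ccoord0] := ch0.
have [Du0 pu0] := par_coord ch0 Pp.
have [U [V [g [[oU oV] [Uu0 UD] fU gV sg]]]] :=
  inverse_function oD0 Du0 (sF c0 A0) J0.
have [Vf0 gf0] := fU _ Uu0; rewrite /= pu0 in Vf0 gf0.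
have [e /= e0 eV] : nbhs_ball (F p) V.
  by apply/nbhs_ballP; exact: open_nbhs_nbhs (conj oV Vf0).
exists e; split=> //.
set rect := `](F p).1 - e, (F p).1 + e[%classic `*`
            `](F p).2 - e, (F p).2 + e[%classic.
have rectB : rect = ball (F p) e.
  exact: open_square_ball.
have oR : open rect by rewrite rectB; exact: ball_open.
have RV : rect `<=` V by rewrite rectB.
have Rp : rect (F p) by rewrite rectB; exact: ballxx.
pose c := Chart rect (par c0 \o g) F.
have FK y : V y -> F (par c0 (g y)) = y by move=> /gV[].
have D0g y : V y -> dom c0 (g y) by move=> /gV[/UD].
have oW : open (U `&` (F \o par c0) @^-1` rect).
  rewrite openE => u [Uu Ru]; apply: filterI; first exact: open_nbhs_nbhs (conj oU Uu).
  have cF : {for u, continuous (F \o par c0)}.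
    exact/differentiable_continuous/(smooth_map_differentiable sF A0 (UD u Uu)).
  exact: cF _ (open_nbhs_nbhs (conj oR Ru)).
have patchE : chart_patch c = par c0 @` (U `&` (F \o par c0) @^-1` rect).
  apply/seteqP; split=> [_ [y Ry <-]|_ [u [Uu Ru] <-]].
    have [Ug Fg] := gV y (RV y Ry); exists (g y) => //; split=> //.
    by rewrite /preimage /= -[F _]/((F \o par c0) (g y)) Fg.
  have [_ gu] := fU u Uu; exists (F (par c0 u)) => //=.
  by rewrite -[F _]/((F \o par c0) u) gu.
have chc : is_chart c.
  split=> //.
  - rewrite patchE; apply: (chart_open_image ch0 oW).
    by move=> u [/UD].
  - by move=> y /RV/FK.
  - move=> y /RV Vy; apply: continuous_comp.
      exact: (sg 0 y Vy).
    exact/cpar0/D0g.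
  - by move=> q _; exact: (smooth_map_continuous sF).
have par_smooth (W : normedModType R) (h : M -> W) : smooth_map A h ->
    smooth_on rect (h \o par c).
  move=> sh k.
  have RD0 y : rect y -> dom c0 (g y) by move=> /RV/D0g.
  exact: (Ck_on_comp oR RD0 (Ck_on_sub RV (sg k)) (sh c0 A0 k)).
exists c; split=> //; last by exists (F p) => //=; rewrite gf0.
split=> // c' A'; split=> k.
  have oO := overlap_open chc (chA A').
  have [_ _ comp _] := atlasA; have [tr _] := comp c0 c' A0 A'.
  have OO y : overlap c c' y -> overlap c0 c' (g y).
    by move=> [/RV/D0g].
  apply: (Ck_on_comp oO OO _ (tr k)); apply: Ck_on_sub (sg k).
  by move=> y [/RV].
by apply: Ck_on_sub (sF c' A' k) => y [].
Qed.

Lemma dmap_pair (U V : normedModType R) (f : M -> U) (g : M -> V) p v :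
  smooth_map A f -> smooth_map A g -> tangent A phi p v ->
  dmap A phi (fun q => (f q, g q)) p v = (dmap A phi f p v, dmap A phi g p v).
Proof.
move=> sf sg [c [u [xi rep]]]; have [Ac Du _ _] := rep.
rewrite (dmapE atlasA immA (smooth_map_pair sf sg) rep).
rewrite (dmapE atlasA immA sf rep) (dmapE atlasA immA sg rep).
apply: derive_pair; first exact: smooth_map_differentiable sf Ac Du.
exact: smooth_map_differentiable sg Ac Du.
Qed.

(** Chain rule for [phi o par c1 = (phi o par c) o (coord c o par c1)], where
    [c1] is a chart of the atlas representing [v]. *)
Lemma derive_par_coordinates c y v :
  is_chart c -> smooth_map A (Defs.coord c) -> dom c y ->
  differentiable (phi \o par c) y -> tangent A phi (par c y) v ->
  'D_(dmap A phi (Defs.coord c) (par c y) v) (phi \o par c) y = v.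
Proof.
move=> chc sF Dy dphi [c1 [u [xi rep]]]; have [A1 Du pu vE] := rep.
have [_ _ cK _ _] := chc.
rewrite (dmapE atlasA immA sF rep).
have Fu : (Defs.coord c \o par c1) u = y by rewrite /= pu cK.
rewrite -[X in 'D__ _ X]Fu -derive_comp; first last.
- by rewrite Fu.
- exact: smooth_map_differentiable sF A1 Du.
rewrite -[RHS]vE; apply: near_eq_derive.
have ou : overlap c1 c u by split=> //; exists y; rewrite // pu.
apply: filterS (open_nbhs_nbhs (conj (overlap_open (chA A1) chc) ou)) => z oz.
by have [_ /=] := par_transition chc oz; rewrite /transition /= => ->.
Qed.

End AdaptedCharts.

(** * The parametrization *)

Theorem theorem1p18 (R : realType) (M : topologicalType)
  (A : set (chart R M)) (phi : M -> 'rV[R]_4)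
  (Z : 'rV[R]_4 -> 'rV[R]_4) (ZT ZN W : M -> 'rV[R]_4)
  (nabla : (M -> 'rV[R]_4) -> (M -> 'rV[R]_4) -> (M -> 'rV[R]_4))
  (a : M -> R) (beta : M -> 'rV[R]_4 -> R)
  (surfM : oriented_surface A)
  (connM : connected [set: M])
  (immM : immersion A phi)
  (spaceM : spacelike_surface A phi)
  (parZ : parallel Z)
  (unitZ : forall x, mink (Z x) (Z x) = 1)
  (decZ : tangent_normal_parts A phi Z ZT ZN)
  (nullZ : forall p, lightlike (ZN p))
  (orW : oriented_unit_normal_to A phi ZT W)
  (LC : levi_civita A phi nabla)
  (aE : forall p, a p = mink (second_ff A phi nabla W W p) (ZN p))
  (beta1 : one_form A phi beta)
  (betaE : forall X, tangent_field A phi X ->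
     forall p, second_ff A phi nabla X ZT p = beta p (X p) *: ZN p)
  (a0 : forall p, a p = 0)
  (beta0 : forall p v, tangent A phi p v -> beta p v = 0) :
  exists Z0 : 'rV[R]_4,
    (forall p, ZT p = Z0) /\
    (forall p, exists (c : chart R M) (x1 x2 y1 y2 : R) (alpha : R -> 'rV[R]_4),
      [/\ parametrization A c,
          chart_patch c p,
          dom c = `]x1, x2[ `*` `]y1, y2[,
          smooth_on `]y1, y2[ alpha /\
          (forall y, y \in `]y1, y2[ -> mink (derive1 alpha y) Z0 = 0) &
          forall x y, x \in `]x1, x2[ -> y \in `]y1, y2[ ->
            phi (par c (x, y)) = alpha y + x *: Z0]).
Proof.
have [_ _ atlasA] := surfM; have [sphi _] := immM.
have [tanZT norZN ZE] := decZ; have [tanW Wfr] := orW.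
pose z0 := Z 0.
have z0E p : z0 = ZT p + ZN p by rewrite -ZE; exact: parallel_const.
have nullN p : mink (ZN p) (ZN p) = 0 by have [] := nullZ p.
have dZT p v : tangent A phi p v -> dmap A phi ZT p v = 0.
  apply: (dmap_tangent_part_eq0 atlasA immM tanZT norZN z0E (unitZ 0) nullN orW LC).
    by move=> q; rewrite -aE.
  move=> X tanX q; rewrite betaE // beta0 ?scale0r //; exact: tanX.2.
have ZTconst := dmap_eq0_constant atlasA immM connM tanZT.1 dZT.
(* The default value 0 only matters for an empty surface. *)
pose Z0 := xget 0 (range ZT).
have ZT0 p : ZT p = Z0.
  have [q _ <-] : range ZT Z0 by apply: (xgetPex 0); exists (ZT p), p.
  exact: ZTconst.
exists Z0; split=> // p.
have ZTunit : mink Z0 Z0 = 1.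
  by rewrite -(ZT0 p) (tangent_part_unit tanZT norZN z0E (unitZ 0) nullN).
have [W1 ZTW [c0 [u0 [xi [eta [rxi reta _]]]]]] := Wfr p.
rewrite ZT0 in ZTW rxi.
pose w0 := W p.
pose F q : R * R := (mink Z0 (phi q), mink w0 (phi q)).
have sF1 := smooth_map_mink atlasA Z0 sphi.
have sF2 := smooth_map_mink atlasA w0 sphi.
have sF : smooth_map A F by exact: smooth_map_pair atlasA _ _ _ _ sF1 sF2.
have dF q v : tangent A phi q v -> dmap A phi F q v = (mink Z0 v, mink w0 v).
  move=> tv; rewrite (dmap_pair atlasA immM sF1 sF2 tv).
  by rewrite !(dmap_mink atlasA immM _ sphi tv) (dmap_phi atlasA immM tv).
have [A0 Du0 pu0 _] := rxi.
have Pp : chart_patch c0 p by exists u0.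
have u0E : Defs.coord c0 p = u0.
  by have [/(_ c0 A0)[_ _ cK _ _] _ _ _] := atlasA; rewrite -pu0 cK.
have dFu0 : differentiable (F \o par c0) u0.
  exact: smooth_map_differentiable sF A0 Du0.
have Dxi : 'D_xi (F \o par c0) u0 = (1, 0).
  rewrite -(dmapE atlasA immM sF rxi) dF; last by exists c0, u0, xi.
  by rewrite ZTunit minkC ZTW.
have Deta : 'D_eta (F \o par c0) u0 = (0, 1).
  rewrite -(dmapE atlasA immM sF reta) dF; last by exists c0, u0, eta.
  by rewrite ZTW W1.
have J0 : Defs.jacobian (F \o par c0) (Defs.coord c0 p) != 0.
  by rewrite u0E; exact: jacobian_neq0 dFu0 Dxi Deta.
have [e [e0 [c [parc Pc domc cF smc]]]] :=
  chart_of_coordinates atlasA sF A0 Pp J0.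
have [chc compc] := parc.
set x1 := _ - e in domc; set x2 := _ + e in domc.
set y1 := _ - e in domc; set y2 := _ + e in domc.
pose x0 := (F p).1.
pose alpha y := phi (par c (x0, y)) - x0 *: Z0.
have domP x y : x \in `]x1, x2[ -> y \in `]y1, y2[ -> dom c (x, y).
  by move=> xI yI; rewrite domc; split.
have x0I : x0 \in `]x1, x2[.
  by rewrite in_itv /= /x1 /x2 ltrBlDr !ltrDl e0.
have sPhi := smc _ phi sphi.
have dPhi x y : dom c (x, y) -> differentiable (phi \o par c) (x, y).
  by move=> D; have [+ _] := sPhi 1; exact.
have DPhi x y : dom c (x, y) -> 'D_((1, 0) : R * R) (phi \o par c) (x, y) = Z0.
  move=> D; have tq : tangent A phi (par c (x, y)) Z0.
    by rewrite -(ZT0 (par c (x, y))); exact: tanZT.2.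
  have := derive_par_coordinates atlasA immM chc _ D (dPhi x y D) tq.
  by rewrite cF dF // ZTunit minkC ZTW; exact.
have oI : open `]y1, y2[%classic by exact: interval_open.
have salpha : smooth_on `]y1, y2[ alpha.
  move=> k; apply: (Ck_onB oI _ (Ck_on_cst k _ (x0 *: Z0))).
  have lineI y : `]y1, y2[%classic y -> dom c (x0, y).
    by move=> yI; exact: domP.
  exact: (Ck_on_comp oI lineI (Ck_on_pair oI (Ck_on_cst k _ x0) (Ck_on_id k _))
    (sPhi k)).
exists c, x1, x2, y1, y2, alpha; split=> //.
- split=> // y yI; rewrite minkC derive1E.
  have dalpha : differentiable alpha y by have [+ _] := salpha 1; exact.
  rewrite -derive_lincomp //; last exact: mink_r_continuous.
  rewrite -[RHS](derive_cst (0 : R) y 1); apply: near_eq_derive.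
  apply: filterS (open_nbhs_nbhs (conj oI yI)) => z zI /=.
  have D : dom c (x0, z) by exact: domP.
  have [_ _ cK _ _] := chc; have := cK _ D; rewrite cF => -[Fx0 _].
  by rewrite /alpha minkBr minkZr ZTunit mulr1 Fx0 subrr.
- move=> x y xI yI; rewrite /alpha.
  (* [K] has zero derivative along horizontal segments of the square. *)
  pose K z := (phi \o par c) z - z.1 *: Z0.
  suff : K ((x0, y) + (x - x0, 0)) = K (x0, y).
    have -> : (x0, y) + (x - x0, 0) = (x, y).
      by congr pair; rewrite /= ?subrKC ?addr0.
    by rewrite /K /= => /eqP; rewrite subr_eq => /eqP.
  apply: segment_derive_eq0_const => t t01.
  have -> : (x0, y) + t *: ((x - x0, 0) : R * R) = (x0 + t * (x - x0), y).
    by congr pair; rewrite /= /GRing.scale /= ?mulr0 ?addr0.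
  have D : dom c (x0 + t * (x - x0), y).
    apply: domP => //; move: x0I xI; rewrite !in_itv /= => x0I xI.
    exact: segment_itv.
  have dfst z : differentiable (fun z : R * R => z.1 *: Z0) z.
    apply: differentiable_scale; last exact: differentiable_cst.
    by apply: linear_differentiable => ?; exact: cvg_fst.
  have dP := dPhi _ _ D; split; first exact: differentiableB.
  rewrite derive_basis; last exact: differentiableB.
  rewrite scale0r addr0 deriveB; [|exact: diff_derivable..].
  have cfst : continuous (fst : R * R -> R) by move=> ?; exact: cvg_fst.
  have dfst' z : differentiable (fst : R * R -> R) z.
    exact: linear_differentiable.
  have -> : 'D_((1, 0) : R * R) (fun z : R * R => z.1 *: Z0)
      (x0 + t * (x - x0), y) = Z0.
    rewrite derive_scale; [|exact: dfst'|exact: differentiable_cst].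
    by rewrite derive_cst scaler0 add0r deriveE ?diff_lin //= scale1r.
  by rewrite DPhi // subrr scaler0.
Qed.
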